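(* The $\mathcal{A}$-linear map $$\phi: V_{m|n}^{\otimes d}\longrightarrow \bigoplus_{\lambda\in\Lambda(m|n,d)}[\mathrm{xy}]_\lambda\mathcal{H},\qquad (-1)^{\widehat{\mathbf{i}}}\,\mathbf{e}_{\mathbf{i}}\mapsto [\mathrm{xy}]_\mu T_{g}\quad(\mathbf{i}\in\mathbb{I}^d),$$ where $\mu=\mathrm{wt}(\mathbf{i})$ and $g\in\mathcal{D}_\mu$ is the element with $\mathbf{i}=\mathbf{i}_\mu g$, is an isomorphism of right $\mathcal{H}$-modules.
   Context: Fix integers $d\ge1$, $m,n\ge0$. Put $\mathcal{A}=\mathbb{Z}[v,v^{-1}]$, $q=v^2$. $W$ is the group of permutations $w$ of $\{-d,\dots,d\}$ with $w(-i)=-w(i)$ (type $\mathrm{B}_d$), with Coxeter generators $s_0=(-1,1)$, $s_i=(i,i+1)(-i,-i-1)$ ($1\le i<d$) and length function $\ell$. $\mathcal{H}$ is the Hecke algebra of $W$: the free $\mathcal{A}$-module with basis $\{T_w\}_{w\in W}$ and $T_wT_{w'}=T_{ww'}$ if $\ell(ww')=\ell(w)+\ell(w')$, $(T_{s_i}+1)(T_{s_i}-q)=0$. $\mathbb{I}=\{-m-n,\dots,m+n\}$ with parity $\widehat{i}=0$ if $|i|\le m$ and $\widehat{i}=1$ if $|i|>m$. $\Lambda(m|n,d)=\{\lambda=(\lambda_0,\dots,\lambda_m|\lambda_{m+1},\dots,\lambda_{m+n})\in\mathbb{N}^{m+n+1}:\sum_i\lambda_i=d\}$, $\widetilde\lambda_i=\lambda_0+\cdots+\lambda_i$.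 $W_\lambda$ is the parabolic subgroup generated by $\{s_0,\dots,s_{d-1}\}\setminus\{s_{\widetilde\lambda_0},\dots,s_{\widetilde\lambda_{m+n-1}}\}$; $W_{\lambda^{(0)}}$ (resp. $W_{\lambda^{(1)}}$) is generated by those generators $s_i\in W_\lambda$ with $i<\widetilde\lambda_m$ (resp. $i>\widetilde\lambda_m$), so $W_\lambda=W_{\lambda^{(0)}}\times W_{\lambda^{(1)}}$. $\mathcal{D}_\lambda$ is the set of shortest right coset representatives of $W_\lambda\backslash W$. $[\mathrm{xy}]_\lambda=\big(\sum_{w\in W_{\lambda^{(0)}}}T_w\big)\big(\sum_{w\in W_{\lambda^{(1)}}}(-q)^{-\ell(w)}T_w\big)\in\mathcal{H}$. $W$ acts on $\mathbb{I}^d$ on the right: $\mathbf{i}s_k$ swaps $i_k,i_{k+1}$ for $k\ge1$, and $\mathbf{i}s_0=(-i_1,i_2,\dots,i_d)$. For $\lambda\in\Lambda(m|n,d)$ let $\mathbf{i}_\lambda=(0^{\lambda_0},1^{\lambda_1},\dots,(m+n)^{\lambda_{m+n}})\in\mathbb{I}^d$. Each $\mathbf{i}\in\mathbb{I}^d$ is $\mathbf{i}_\lambda g$ for a unique $\lambda=:\mathrm{wt}(\mathbf{i})$ and a unique $g\in\mathcal{D}_\lambda$. The parity $\widehat{\mathbf{i}}\in\{0,1\}$ is $\widehat{\mathbf{i}}\equiv\sum_{k<l,\,i_k>i_l}\widehat{i_k}\,\widehat{i_l}+\sum_{k\le l,\,-i_k>i_l}\widehat{i_k}\,\widehat{i_l}\pmod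 2$. $V_{m|n}$ is the free $\mathcal{A}$-module with basis $\{e_i\}_{i\in\mathbb{I}}$. For $\mathbf{i}\in\mathbb{I}^d$, $\mathbf{e}_{\mathbf{i}}=v^{|\mathbf{i}|}e_{i_1}\otimes\cdots\otimes e_{i_d}$ with $|\mathbf{i}|=\#\{(k,l)\in[1,d]^2:k<l,\ i_k>i_l\}+\#\{(k,l)\in[1,d]^2:k\le l,\ -i_k>i_l\}$. The right $\mathcal{H}$-action on $V_{m|n}^{\otimes d}$ is: for $1\le k<d$, $\mathbf{e}_{\mathbf{i}}T_{s_k}=(-1)^{\widehat{i_k}\widehat{i_{k+1}}}\mathbf{e}_{\mathbf{i}s_k}$ if $i_k<i_{k+1}$; $=q\,\mathbf{e}_{\mathbf{i}}$ if $i_k=i_{k+1}$ is even; $=-\mathbf{e}_{\mathbf{i}}$ if $i_k=i_{k+1}$ is odd; $=(-1)^{\widehat{i_k}\widehat{i_{k+1}}}q\,\mathbf{e}_{\mathbf{i}s_k}+(q-1)\mathbf{e}_{\mathbf{i}}$ if $i_k>i_{k+1}$; and $\mathbf{e}_{\mathbf{i}}T_{s_0}=(-1)^{\widehat{i_1}}\mathbf{e}_{\mathbf{i}s_0}$ if $i_1>0$; $=q\,\mathbf{e}_{\mathbf{i}}$ if $i_1=0$; $=(-1)^{\widehat{i_1}}q\,\mathbf{e}_{\mathbf{i}s_0}+(q-1)\mathbf{e}_{\mathbf{i}}$ if $i_1<0$. (Even/odd refers to the parity $\widehat{\ }$ on $\mathbb{I}$.) *)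

(* Defs.v *)
From HB Require Import structures.
From mathcomp Require Import all_boot all_order all_fingroup all_algebra.
From mathcomp Require Import fraction boolp zify.

Set Implicit Arguments.
Unset Strict Implicit.
Unset Printing Implicit Defensive.

Import Order.TTheory GRing.Theory Num.Theory GroupScope.
Local Open Scope ring_scope.

(* The ring Z[v, v^-1], as the subring of Z(v) of all f with f * v ^+ n in    *)
(* Z[v] for some n.                                                           *)
Definition fracX : {fraction {poly int}} := tofrac 'X.

Definition is_laurent : {pred {fraction {poly int}}} :=
  fun f => `[< exists (n : nat) (p : {poly int}), f * fracX ^+ n = tofrac p >].

Lemma fracX_neq0 : fracX != 0.
Proof. by rewrite /fracX tofrac_eq0 polyX_eq0. Qed.

Lemma is_laurent_subring : subring_closed is_laurent.
Proof.
split.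
- by apply/asboolP; exists 0%N, 1; rewrite expr0 mulr1 tofrac1.
- move=> f g /asboolP[a [p Hp]] /asboolP[b [r Hr]]; apply/asboolP.
  exists (a + b)%N, (p * 'X^b - r * 'X^a).
  rewrite tofracB !tofracM !tofracXn -/fracX -Hp -Hr exprD mulrBl.
  by rewrite mulrA -!(mulrA g) (mulrC (fracX ^+ a)).
- move=> f g /asboolP[a [p Hp]] /asboolP[b [r Hr]]; apply/asboolP.
  exists (a + b)%N, (p * r).
  by rewrite tofracM -Hp -Hr exprD mulrACA.
Qed.

HB.instance Definition _ :=
  GRing.isSubringClosed.Build _ is_laurent is_laurent_subring.

Record laurent := Laurent {
  laurent_val :> {fraction {poly int}};
  _ : laurent_val \in is_laurent }.

HB.instance Definition _ := [isSub for laurent_val].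
HB.instance Definition _ := [Choice of laurent by <:].
HB.instance Definition _ := [SubChoice_isSubComNzRing of laurent by <:].

Lemma laurent_val_neq0 (x : laurent) : (val x != 0) = (x != 0).
Proof. by rewrite -(inj_eq val_inj). Qed.

Definition laurent_unit : {pred laurent} :=
  fun x => (x != 0) && ((val x)^-1 \in is_laurent).
Definition laurent_inv (x : laurent) : laurent :=
  if laurent_unit x then insubd x (val x)^-1 else x.

Lemma laurent_mulVx : {in laurent_unit, left_inverse 1 laurent_inv *%R}.
Proof.
move=> x ux; rewrite /laurent_inv [laurent_unit x]ux.
case/andP: ux => x0 xi; apply: val_inj.
have E : val (insubd x (val x)^-1) = (val x)^-1 by rewrite val_insubd xi.
by rewrite rmorphM [X in X * _]E mulVf ?rmorph1 ?laurent_val_neq0.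
Qed.

Lemma laurent_unitPl (x y : laurent) : y * x = 1 -> laurent_unit x.
Proof.
move=> yx; have x0 : x != 0.
  by apply/eqP=> x0; move: yx => /eqP; rewrite x0 mulr0 eq_sym oner_eq0.
have vx0 : val x != 0 by rewrite laurent_val_neq0.
rewrite /laurent_unit x0 /=; suff -> : (val x)^-1 = val y by exact: valP.
by apply: (mulIf vx0); rewrite mulVf // -rmorphM yx rmorph1.
Qed.

Lemma laurent_inv_out : {in [predC laurent_unit], laurent_inv =1 id}.
Proof. by move=> x; rewrite inE /laurent_inv => /negbTE nx; rewrite [laurent_unit x]nx. Qed.

HB.instance Definition _ := GRing.ComNzRing_hasMulInverse.Build laurent
  laurent_mulVx laurent_unitPl laurent_inv_out.

Lemma fracX_laurent : fracX \in is_laurent.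
Proof. by apply/asboolP; exists 0%N, 'X; rewrite mulr1. Qed.

Definition v : laurent := Laurent fracX_laurent.
Definition q : laurent := v ^+ 2.

Lemma v_unit : v \is a GRing.unit.
Proof.
apply/andP; split.
  by rewrite -laurent_val_neq0 fracX_neq0.
by apply/asboolP; exists 1%N, 1; rewrite expr1 mulVf ?fracX_neq0 ?tofrac1.
Qed.

(* The interval {-N, ..., N}. *)
Record sint (N : nat) := Sint { sint_val :> int; _ : (absz sint_val <= N)%N }.

HB.instance Definition _ N := [isSub for @sint_val N].
HB.instance Definition _ N := [Countable of sint N by <:].

Section SintFinite.
Variable N : nat.

Definition sint_code (z : sint N) : bool * 'I_N.+1 :=
  ((z : int) < 0, inord (absz z)).
Definition sint_decode (p : bool * 'I_N.+1) : option (sint N) :=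
  insub ((-1) ^+ p.1 * (p.2 : nat)%:Z).

Lemma sint_codeK : pcancel sint_code sint_decode.
Proof.
move=> [z zN]; rewrite /sint_decode /sint_code /= inordK ?ltnS //.
have -> : (-1) ^+ (z < 0)%R * (absz z)%:Z = z.
  by case: z zN => n nN //=; rewrite ?expr0 ?expr1 ?mul1r ?mulN1r.
by rewrite insubT.
Qed.
End SintFinite.

HB.instance Definition _ N : isFinite (sint N) := PCanIsFinite (@sint_codeK N).

Section Sint.
Variable N : nat.

Definition sint0 : sint N := @Sint N 0 (leq0n N).
(* Junk value 0 outside {-N, ..., N}. *)
Definition to_sint (z : int) : sint N := insubd sint0 z.
Fact sint_opp_subproof (i : sint N) : (absz (- (i : int)) <= N)%N.
Proof. by rewrite abszN; case: i. Qed.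
Definition sint_opp (i : sint N) : sint N := Sint (sint_opp_subproof i).

Lemma sint_oppK : involutive sint_opp.
Proof. by move=> i; apply: val_inj; rewrite /= opprK. Qed.

Lemma to_sintK (z : int) : (absz z <= N)%N -> to_sint z = z :> int.
Proof. by move=> zN; rewrite [LHS]val_insubd zN. Qed.

Lemma to_sint_val (i : sint N) : to_sint i = i.
Proof. by apply: val_inj; apply: to_sintK; case: i. Qed.

Lemma sint_opp0 : sint_opp sint0 = sint0.
Proof. exact: val_inj. Qed.

Lemma to_sintN z : to_sint (- z) = sint_opp (to_sint z).
Proof.
case: (leqP (absz z) N) => zN.
  by apply: val_inj; rewrite /= !to_sintK // abszN.
by rewrite /to_sint /insubd !insubF ?abszN 1?leqNgt ?zN //= sint_opp0.
Qed.
End Sint.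
Arguments to_sint : clear implicits.

Section Weyl.
Variable d : nat.

Definition signed_perm : {set {perm sint d}} :=
  [set w : {perm sint d} | [forall i, w (sint_opp i) == sint_opp (w i)]].

Lemma signed_permP (w : {perm sint d}) :
  reflect (forall i, w (sint_opp i) = sint_opp (w i)) (w \in signed_perm).
Proof. by rewrite inE; apply: (iffP forallP) => h i; apply/eqP. Qed.

Lemma signed_perm_group_set : group_set signed_perm.
Proof.
apply/group_setP; split; first by apply/signed_permP=> i; rewrite !perm1.
move=> x y /signed_permP hx /signed_permP hy; apply/signed_permP=> i.
by rewrite !permM hx hy.
Qed.
Canonical signed_perm_group := Group signed_perm_group_set.

(* In this group (x * y) i = y (x i); for the opposite convention, w |-> w^-1 *)
(* is an isomorphism fixing the Coxeter generators.                           *)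
Definition weyl : finGroupType := [subg signed_perm_group]%type.

Definition sgen_perm (k : 'I_d) : {perm sint d} :=
  if k == 0%N :> nat then tperm (to_sint d (-1)) (to_sint d 1)
  else (tperm (to_sint d k%:Z) (to_sint d k.+1%:Z) *
        tperm (to_sint d (- k%:Z)) (to_sint d (- k.+1%:Z)))%g.

Lemma tperm_opp (x y i : sint d) :
  sint_opp (tperm x y i) = tperm (sint_opp x) (sint_opp y) (sint_opp i).
Proof. by rewrite (inj_tperm _ _ _ (can_inj (@sint_oppK d))). Qed.

Lemma to_sint_eq (a b : int) : (absz a <= d)%N -> (absz b <= d)%N ->
  (to_sint d a == to_sint d b) = (a == b).
Proof. by move=> ha hb; rewrite -(inj_eq val_inj) /= !to_sintK. Qed.

Lemma sgen_signed k : sgen_perm k \in signed_perm.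
Proof.
apply/signed_permP=> i; rewrite /sgen_perm; case: eqP => [_|/eqP k0].
  by rewrite tperm_opp -!to_sintN opprK tpermC.
have kd := ltn_ord k.
rewrite !permM !tperm_opp -!to_sintN !opprK -!permM conjgC tpermJ.
by rewrite !tpermD // to_sint_eq ?abszN //= ?(ltnW kd) //; lia.
Qed.

Definition sgen (k : 'I_d) : weyl := Subg (sgen_signed k).

(* The least k such that w is a product of k Coxeter generators. The partial  *)
(* products of a reduced word are pairwise distinct, whence k < #|weyl|.      *)
Definition len (w : weyl) : nat :=
  find (fun k => w \in ([set sgen j | j : 'I_d] ^+ k)%g) (iota 0 #|weyl|).

End Weyl.

Section Sequences.
Variables d N : nat.

(* Positions are numbered from 0, so that k stands for position k + 1.        *)
Definition iseq := {ffun 'I_d -> sint N}.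

(* The extension of i to {-d, ..., d} as an odd function.                     *)
Definition entry (i : iseq) (j : sint d) : sint N :=
  if insub (absz j).-1 is Some k then
    if 0 < (j : int) then i k else
    if (j : int) < 0 then sint_opp (i k) else sint0 N
  else sint0 N.

(* The right action of W, extending the given action of the generators: see   *)
(* wact_sgen0 and wact_sgenS.                                                 *)
Definition wact (i : iseq) (w : weyl d) : iseq :=
  [ffun k : 'I_d => entry i ((sgval w)^-1%g (to_sint d k.+1%:Z))].

Lemma entry_opp i j : entry i (sint_opp j) = sint_opp (entry i j).
Proof.
rewrite /entry /= abszN oppr_gt0 oppr_lt0.
case: insub => [k|]; last by rewrite sint_opp0.
by case: (ltgtP (j : int) 0) => _; rewrite ?sint_oppK ?sint_opp0.
Qed.

Lemma entryS i (k : 'I_d) : entry i (to_sint d k.+1%:Z) = i k.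
Proof. by rewrite /entry to_sintK //= valK. Qed.

Lemma entryN i (k : 'I_d) : entry i (to_sint d (- k.+1%:Z)) = sint_opp (i k).
Proof. by rewrite to_sintN entry_opp entryS. Qed.

Lemma entry_wact i w j : entry (wact i w) j = entry i ((sgval w)^-1%g j).
Proof.
have := groupVr (valP w : sgval w \in signed_perm_group d).
set w' := (sgval w)^-1%g => /signed_permP wN.
have pos (k : 'I_d) : entry (wact i w) (to_sint d k.+1%:Z) =
    entry i (w' (to_sint d k.+1%:Z)) by rewrite entryS ffunE.
rewrite -(to_sint_val j).
have: (absz (j : int) <= d)%N by exact: (valP j).
case: (j : int) => [[|k]|k] /= kd.
- have w0 : w' (sint0 d) = sint0 d.
    have := wN (sint0 d); rewrite sint_opp0 => /(congr1 val) /= h.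
    by apply: val_inj => /=; lia.
  have -> : to_sint d 0 = sint0 d by apply: val_inj; rewrite /= to_sintK.
  by rewrite w0 /entry /=; case: insub => // ?; case: insub.
- exact: (pos (Ordinal kd)).
- by rewrite NegzE to_sintN entry_opp wN entry_opp (pos (Ordinal kd)).
Qed.

Lemma wact1 i : wact i 1%g = i.
Proof. by apply/ffunP=> k; rewrite ffunE /= invg1 perm1 entryS. Qed.

Lemma wactM i x y : wact i (x * y)%g = wact (wact i x) y.
Proof.
by apply/ffunP=> k; rewrite !ffunE /= entry_wact invMg permM.
Qed.

Lemma wact_sgen0 i (k : 'I_d) : k = 0%N :> nat ->
  wact i (sgen k) = [ffun l => if l == k then sint_opp (i l) else i l].
Proof.
move=> k0; apply/ffunP=> l; rewrite !ffunE /= /sgen_perm k0 eqxx tpermV.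
have d0 : (0 < d)%N by rewrite -k0 ltn_ord.
have k1 : k.+1%:Z = 1 by rewrite k0.
case: eqP => [->|/eqP lk]; first by rewrite k1 tpermR -entryN k1.
have ld := ltn_ord l; move: lk; rewrite -val_eqE /= k0 => l0.
by rewrite tpermD ?entryS // to_sint_eq //; lia.
Qed.

Lemma wact_sgenS i (k : 'I_d) : k != 0%N :> nat ->
  wact i (sgen k) = [ffun l => i (tperm (ord_pred k) k l)].
Proof.
move=> k0; apply/ffunP=> l; rewrite !ffunE /= /sgen_perm (negbTE k0).
have kd := ltn_ord k; have ld := ltn_ord l.
have kp : (ord_pred k : nat) = k.-1.
  by rewrite /= -subn1 -addnBAC ?lt0n // modnDr modn_small ?subn1 //; lia.
have kpS : (ord_pred k : nat).+1 = k by rewrite kp prednK ?lt0n.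
rewrite invMg !tpermV permM.
rewrite (@tpermD _ (to_sint d (- k%:Z))); first last.
- by rewrite to_sint_eq ?abszN //=; lia.
- by rewrite to_sint_eq ?abszN //= ?(ltnW kd) //; lia.
case: (tpermP (ord_pred k) k l) => [->|->|/eqP lp /eqP lk].
- by rewrite kpS tpermL entryS.
- by rewrite tpermR -{1}kpS entryS.
have lp' : (l : nat) != k.-1 by rewrite -kp val_eqE.
have lk' : (l : nat) != k by rewrite val_eqE.
by rewrite tpermD ?entryS // to_sint_eq //= ?(ltnW kd) //; lia.
Qed.

End Sequences.

Section Hecke.
Variables (d : nat) (H : algType laurent) (T : weyl d -> H).

(* T exhibits H as the Hecke algebra of W. The identities T 1 * T w = T w     *)
(* force T 1 = 1.                                                             *)
Definition is_hecke : Prop :=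
  [/\ forall h : H, exists! c : {ffun weyl d -> laurent},
        h = \sum_w c w *: T w,
      forall w w' : weyl d, len (w * w')%g = (len w + len w')%N ->
        T w * T w' = T (w * w')%g
    & forall k : 'I_d, (T (sgen k) + 1) * (T (sgen k) - q%:A) = 0].

Definition is_right_module (V : lmodType laurent) (act : V -> H -> V) : Prop :=
  [/\ forall h, linear (act^~ h),
      forall x, linear (act x),
      forall x, act x 1 = x
    & forall x h h', act x (h * h') = act (act x h) h'].

End Hecke.

Section Weights.
Variables m n d : nat.

Definition weight : finType :=
  {lam : {ffun 'I_(m + n).+1 -> 'I_d.+1} | (\sum_a lam a == d)%N}.

Definition lam_sum (lam : weight) (i : nat) : nat :=
  (\sum_(a < (m + n).+1 | a <= i) val lam a)%N.

Definition J_ (lam : weight) : {set 'I_d} :=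
  [set k : 'I_d | [forall j : 'I_(m + n), k != lam_sum lam j :> nat]].
Definition J0_ (lam : weight) : {set 'I_d} :=
  [set k in J_ lam | (k < lam_sum lam m)%N].
Definition J1_ (lam : weight) : {set 'I_d} :=
  [set k in J_ lam | (lam_sum lam m < k)%N].

Definition parabolic (J : {set 'I_d}) : {set weyl d} := <<@sgen d @: J>>%g.

Definition D_ (lam : weight) : {set weyl d} :=
  [set g | [forall w in parabolic (J_ lam), (len g <= len (w * g)%g)%N]].

Definition i_ (lam : weight) : iseq d (m + n) :=
  [ffun k : 'I_d => to_sint (m + n) (nth 0%N (flatten
     [seq nseq (val lam a) (a : nat) | a <- enum 'I_(m + n).+1]) k)%:Z].

Variables (H : algType laurent) (T : weyl d -> H).

(* The direct sum of the right ideals xy lam * H, as the submodule dsum_mem   *)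
(* of the finite power of H indexed by the weights.                           *)
Definition xy (lam : weight) : H :=
  (\sum_(w in parabolic (J0_ lam)) T w) *
  (\sum_(w in parabolic (J1_ lam)) (- q) ^- len w *: T w).

Definition dsum_mem (y : {ffun weight -> H}) : Prop :=
  forall lam, exists h, y lam = xy lam * h.

Definition dsum_act (y : {ffun weight -> H}) (h : H) : {ffun weight -> H} :=
  [ffun lam => y lam * h].

Definition dsum_in (lam : weight) (h : H) : {ffun weight -> H} :=
  [ffun mu => if mu == lam then h else 0].

End Weights.
Arguments i_ {m n d} lam.
Arguments D_ {m n d} lam.

Section TensorSpace.
Variables m n d : nat.
Local Notation N := (m + n)%N.

Definition parity (a : sint N) : bool := (m < absz a)%N.

Definition inv_pairs (i : iseq d N) : {set 'I_d * 'I_d} :=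
  [set p : 'I_d * 'I_d | (p.1 < p.2)%N && ((i p.2 : int) < i p.1)].
Definition neg_pairs (i : iseq d N) : {set 'I_d * 'I_d} :=
  [set p : 'I_d * 'I_d | (p.1 <= p.2)%N && ((i p.2 : int) < - (i p.1 : int))].

Definition iparity (i : iseq d N) : bool :=
  odd (\sum_(p in inv_pairs i) parity (i p.1) * parity (i p.2) +
       \sum_(p in neg_pairs i) parity (i p.1) * parity (i p.2)).

Definition V_ := {ffun sint N -> laurent^o}.
Definition e_ (a : sint N) : V_ := [ffun b => (b == a)%:R].

(* The d-th tensor power of V_, in coordinates for the basis of pure tensors  *)
(* of the e_ a.                                                               *)
Definition Vtens := {ffun iseq d N -> laurent^o}.
Definition tens (x : 'I_d -> V_) : Vtens := [ffun i : iseq d N => \prod_k x k (i k)].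

Definition eb (i : iseq d N) : Vtens :=
  v ^+ (#|inv_pairs i| + #|neg_pairs i|) *: tens (fun k => e_ (i k)).

(* eb i * T_(s_k); for k > 0 the positions k and k + 1 (numbered from 1) are  *)
(* the ordinals ord_pred k and k.                                             *)
Definition eb_act_gen (i : iseq d N) (k : 'I_d) : Vtens :=
  if k == 0%N :> nat then
    let a := i k in
    if 0 < (a : int) then (-1) ^+ parity a *: eb (wact i (sgen k))
    else if a == 0 :> int then q *: eb i
    else ((-1) ^+ parity a * q) *: eb (wact i (sgen k)) + (q - 1) *: eb i
  else
    let a := i (ord_pred k) in let b := i k in
    let sgn : laurent := (-1) ^+ (parity a * parity b) in
    if (a : int) < b then sgn *: eb (wact i (sgen k))
    else if a == b then (if parity a then - eb i else q *: eb i)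
    else (sgn * q) *: eb (wact i (sgen k)) + (q - 1) *: eb i.

End TensorSpace.
Arguments parity m n a : clear implicits.
Arguments iparity m n {d} i.
Arguments eb m n {d} i.
Arguments eb_act_gen m n {d} i k.

(* Main.v *)
Require Import Defs.
From HB Require Import structures.
From mathcomp Require Import all_boot all_order all_fingroup all_algebra.
From mathcomp Require Import zify ring.

Set Implicit Arguments.
Unset Strict Implicit.
Unset Printing Implicit Defensive.

Import Order.TTheory GRing.Theory Num.Theory.
Local Open Scope ring_scope.

(* Everything is read off sequences. Acting by s_k on a sequence i compares   *)
(* two entries of its odd extension and changes the number of inversions by   *)
(* 1, 0 or -1; for the regular sequence (1, .., d) this number is the length. *)
(* Write i = i_mu g. Since i_mu is weakly increasing, a strict ascent of i at *)
(* s_k is also an ascent of (1, .., d) u g for each u fixing i_mu. Hence      *)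
(* building i from i_mu by ascents yields the g with l(u g) = l(u) + l(g) for *)
(* all u in W_mu, and these g are the elements of D_mu. If i s_k = i, then    *)
(* g s_k = u g with u fixing i_mu, and additivity forces l(u) = 1, so that    *)
(* g s_k = s_j g with s_j in W_mu. The three cases match the three cases of   *)
(* the action, which gives equivariance. As xy_mu T_g = sum c_u T_(u g) with  *)
(* u in W_mu and c_1 = 1, the elements xy_mu T_g are linearly independent;    *)
(* surjectivity follows by acting on the i_mu.                                *)

(** * Inversions and length *)

(** The proof matches two bases and the action of the generators on them. Pairs of a weight [mu] and
    an element of [D_ mu] parametrise the sequences ([rep_ex], [rep_uniq]), so the signed vectors
    [seb (pt p)] form a basis of the tensor space ([sum_coord]), and phi sends them to the elements
    [target p].

    One weighted inversion count, [stat], governs both the length ([lenE]) and the sign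
    ([iparity_asc]). The change of sign from i to i s_k is exactly the sign in the given action, so
    on the signed basis T_(s_k) acts without signs, by the same rule as on the [target p]:
    [target_asc], [target_desc], [target_eq]. In the case of equal entries, [xy_sgen] provides the
    eigenvalue q or -1 of T_(s_j) on [xy]_mu, and [parity_i_] shows that it is the one dictated by
    the parity of the entry.

    Injectivity of phi is [xy_T_free]. The image is the whole sum because [xy]_mu is itself the
    image of a signed basis vector and phi is equivariant ([phi_image]). *)

Lemma sint_eqE N (a b : sint N) : (a == b) = (a == b :> int).
Proof. by []. Qed.

Lemma sint_eqP N (a b : sint N) : a = b :> int -> a = b.
Proof. exact: val_inj. Qed.

Lemma sint_oppE N (a : sint N) : sint_opp a = - (a : int) :> int.
Proof. by []. Qed.

Lemma sint_le N (a : sint N) : (absz a <= N)%N.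
Proof. by case: a. Qed.

Section Local.
Variables d N : nat.
Implicit Types (i : iseq d N) (k : 'I_d).

(* sgen k exchanges lo k and hi k, so that k = 0 needs no separate treatment. *)
Definition lo k : sint d :=
  if k == 0%N :> nat then to_sint d (-1) else to_sint d k%:Z.
Definition hi k : sint d := to_sint d k.+1%:Z.
Definition lft i k : sint N := entry i (lo k).

Lemma hiE k : hi k = k.+1%:Z :> int.
Proof. by rewrite /hi to_sintK //= ltn_ord. Qed.

Lemma loE k : lo k = (if k == 0%N :> nat then -1 else k%:Z) :> int.
Proof.
have kd := ltn_ord k.
by rewrite /lo; case: eqP => k0; rewrite to_sintK //=; lia.
Qed.

Lemma entry_hi i k : entry i (hi k) = i k.
Proof. exact: entryS. Qed.

Lemma lft0 i k : k = 0%N :> nat -> lft i k = sint_opp (i k).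
Proof. by move=> k0; rewrite /lft /lo k0 eqxx -entryN k0. Qed.

Lemma ord_predE k : k != 0%N :> nat -> ord_pred k = k.-1 :> nat.
Proof.
move=> k0; have kd := ltn_ord k.
by rewrite /= -subn1 -addnBAC ?lt0n // modnDr modn_small ?subn1 //; lia.
Qed.

Lemma lftS i k : k != 0%N :> nat -> lft i k = i (ord_pred k).
Proof.
move=> k0; rewrite /lft /lo (negbTE k0) -[RHS]entryS.
by rewrite ord_predE // prednK ?lt0n.
Qed.

Lemma wact_sgen_hi i k : wact i (sgen k) k = lft i k.
Proof.
case: (eqVneq (k : nat) 0%N) => k0.
  by rewrite wact_sgen0 // ffunE eqxx lft0.
by rewrite wact_sgenS // ffunE tpermR lftS.
Qed.

Lemma wact_sgen_lo i k : lft (wact i (sgen k)) k = i k.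
Proof.
case: (eqVneq (k : nat) 0%N) => k0.
  by rewrite lft0 // wact_sgen0 // ffunE eqxx sint_oppK.
by rewrite lftS // wact_sgenS // ffunE tpermL.
Qed.

Lemma wact_sgenK i k : wact (wact i (sgen k)) (sgen k) = i.
Proof.
case: (eqVneq (k : nat) 0%N) => k0; apply/ffunP=> l.
  rewrite !wact_sgen0 // !ffunE.
  by case: eqP => // _; rewrite sint_oppK.
by rewrite !wact_sgenS // !ffunE tpermK.
Qed.

Lemma wact_sgen_id i k : lft i k = i k -> wact i (sgen k) = i.
Proof.
case: (eqVneq (k : nat) 0%N) => k0; [rewrite lft0 // | rewrite lftS //] => e.
  by rewrite wact_sgen0 //; apply/ffunP=> l; rewrite ffunE; case: eqP => // ->.
rewrite wact_sgenS //; apply/ffunP=> l; rewrite ffunE.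
by case: tpermP => // ->.
Qed.

(** Type B inversions, weighted by [F]; the last sum is the diagonal case of [-i_k > i_l]. Weight 1
    gives the length, the product of parities gives [iparity]. *)
Definition stat (F : sint N -> sint N -> nat) i : nat :=
  (\sum_(p : 'I_d * 'I_d)
    ((p.1 < p.2)%N * (((i p.2 : int) < i p.1)%R + ((i p.2 : int) < - (i p.1 : int))%R)
        * F (i p.1) (i p.2))
   + \sum_k ((i k : int) < 0)%R * F (i k) (i k))%N.

(** Exactly one inversion is created: at the pair of exchanged positions, or on the diagonal at the
    first position when [k] is 0. The remaining contributions are only rearranged, since [F] is
    symmetric and blind to signs. *)
Lemma stat_asc F i k :
    (forall a b, F a b = F b a) -> (forall a b, F (sint_opp a) b = F a b) ->
  (lft i k : int) < i k ->
  stat F (wact i (sgen k)) = (stat F i + F (lft i k) (i k))%N.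
Proof.
move=> Fsym Fopp.
case: (eqVneq (k : nat) 0%N) => k0; [rewrite lft0 // | rewrite lftS //] => ltk.
  have {ltk} ik : 0 < (i k : int) by move: ltk; rewrite sint_oppE; lia.
  rewrite wact_sgen0 // /stat Fopp -addnA; congr addn.
    apply: eq_bigr => -[p r] _ /=; rewrite !ffunE.
    case: (ltnP p r) => // pr; rewrite !mul1n.
    have -> : (r == k) = false by apply/eqP=> rk; move: pr; rewrite rk k0.
    (* Negating the first entry exchanges the two inversion conditions against any later entry. *)
    case: eqP => // ->; rewrite Fopp sint_oppE opprK addnC //.
  rewrite (bigD1 k) //= [in RHS](bigD1 k) //= ffunE eqxx sint_oppE.
  rewrite oppr_lt0 ik (lt_gtF ik) mul0n mul1n add0n Fopp Fsym Fopp addnC.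
  congr addn; apply: eq_bigr => l /negbTE lk; rewrite ffunE lk //.
have kp := ord_predE k0.
set k' := ord_pred k in ltk kp *.
have kk' : k' != k by apply/eqP => /(congr1 (@nat_of_ord d)); rewrite kp; lia.
rewrite wact_sgenS // -/k' /stat addnAC; congr addn; last first.
  rewrite [RHS](reindex_inj (@perm_inj _ (tperm k' k))).
  by apply: eq_bigr => l _; rewrite ffunE.
(* Transposing both coordinates restores the entries. As the positions are adjacent, only the pairs
   [(k', k)] and [(k, k')] have their order reversed. *)
rewrite (reindex_inj (h := fun p => (tperm k' k p.1, tperm k' k p.2))); last first.
  by move=> [p r] [p' r'] /= [/perm_inj -> /perm_inj ->].
rewrite (bigD1 (k', k)) //= (bigD1 (k, k')) /=; last first.
  by rewrite xpair_eqE eq_sym (negbTE kk').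
rewrite [in RHS](bigD1 (k', k)) //= [in RHS](bigD1 (k, k')) /=; last first.
  by rewrite xpair_eqE eq_sym (negbTE kk').
rewrite !ffunE !(tpermL, tpermR).
have -> : (k' < k)%N by rewrite kp; lia.
have -> : (k < k')%N = false by rewrite kp; lia.
have -> : ((i k' : int) < i k) = true by [].
have -> : ((i k : int) < i k') = false by lia.
have -> : ((i k : int) < - (i k' : int)) = ((i k' : int) < - (i k : int)) by lia.
rewrite (Fsym (i k) (i k')) !mul0n !mul1n !add0n mulnDl mul1n.
set A := (\sum_(_ | _) _)%N; set B := (\sum_(_ | _) _)%N.
suff -> : A = B by lia.
apply: eq_bigr => -[p r] /andP[]; rewrite !xpair_eqE !negb_and /= => h1 h2.
rewrite !ffunE !tpermK; congr ((nat_of_bool _ * _) * _)%N.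
have kd := ltn_ord k.
move: h1 h2.
have E (x y : 'I_d) : (x == y) = (nat_of_ord x == nat_of_ord y) by [].
by do 2![case: tpermP => [->|->|/eqP + /eqP +]]; rewrite !E !kp; lia.
Qed.

End Local.

Section Length.
Variable d : nat.
Implicit Types (w u g : weyl d) (k : 'I_d).

(** The odd extension of this sequence is the identity, so [wact i0 w] records the inverse of
    [w]. *)
Definition i0 : iseq d d := [ffun k => hi k].

Lemma entry_i0 x : entry i0 x = x.
Proof.
rewrite -[RHS]to_sint_val -{1}(to_sint_val x); have := sint_le x.
case: (x : int) => [[|k]|k] /= kd.
- by apply: sint_eqP; rewrite /entry to_sintK //=; case: insub.
- by rewrite (entryS i0 (Ordinal kd)) ffunE.
- by rewrite NegzE (entryN i0 (Ordinal kd)) ffunE to_sintN.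
Qed.

Lemma entry_wact_i0 w x : entry (wact i0 w) x = (sgval w)^-1%g x.
Proof. by rewrite entry_wact entry_i0. Qed.

Lemma wact_i0 w k : wact i0 w k = (sgval w)^-1%g (hi k).
Proof. by rewrite -entry_hi entry_wact_i0. Qed.

Lemma lft_i0 w k : lft (wact i0 w) k = (sgval w)^-1%g (lo k).
Proof. exact: entry_wact_i0. Qed.

Lemma wact_entry N (i : iseq d N) w k : wact i w k = entry i (wact i0 w k).
Proof. by rewrite wact_i0 -entry_wact entry_hi. Qed.

Lemma lft_entry N (i : iseq d N) w k :
  lft (wact i w) k = entry i (lft (wact i0 w) k).
Proof. by rewrite lft_i0 -entry_wact. Qed.

Lemma wact_i0_inj : injective (wact i0).
Proof.
move=> w u e; apply: val_inj; apply: (@invg_inj {perm sint d}).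
by apply/permP=> x; rewrite -!entry_wact_i0 e.
Qed.

Lemma sgenK k : (sgen k * sgen k)%g = 1%g.
Proof. by apply: wact_i0_inj; rewrite wactM wact_sgenK wact1. Qed.

Lemma mulgsK w k : (w * sgen k * sgen k)%g = w.
Proof. by rewrite -mulgA sgenK mulg1. Qed.

Lemma lft_i0_neq w k : lft (wact i0 w) k != wact i0 w k :> int.
Proof.
rewrite -sint_eqE lft_i0 wact_i0 (inj_eq perm_inj) sint_eqE loE hiE.
by case: ifP; lia.
Qed.

Lemma sgen_neq1 k : sgen k != 1%g.
Proof.
apply/eqP=> e; have := lft_i0_neq 1 k.
by rewrite wact1 -wact_sgen_hi e wact1 eqxx.
Qed.

Definition invs N (i : iseq d N) : nat := stat (fun _ _ => 1%N) i.

Lemma invs_asc N (i : iseq d N) k :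
  (lft i k : int) < i k -> invs (wact i (sgen k)) = (invs i).+1.
Proof. by move=> lt; rewrite /invs stat_asc ?addn1. Qed.

Lemma invs_desc N (i : iseq d N) k :
  (i k : int) < lft i k -> invs i = (invs (wact i (sgen k))).+1.
Proof.
by move=> lt; rewrite -(@invs_asc _ _ k) ?wact_sgenK // wact_sgen_lo wact_sgen_hi.
Qed.

(** At [k = 0] the condition reads [-i_1 <= i_1]; the dominant sequences are thus those with
    [0 <= i_1 <= .. <= i_d]. *)
Definition dominant N (i : iseq d N) : bool :=
  [forall k, (lft i k : int) <= i k].

Lemma dominantP N (i : iseq d N) :
  reflect (forall k, (lft i k : int) <= i k) (dominant i).
Proof. exact: forallP. Qed.

Lemma ndominantP N (i : iseq d N) :
  reflect (exists k, (i k : int) < lft i k) (~~ dominant i).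
Proof.
by rewrite negb_forall; apply: (iffP existsP) => -[k]; exists k;
  [rewrite ltNge | rewrite -ltNge].
Qed.

Lemma entry0 N (i : iseq d N) : entry i (to_sint d 0) = 0 :> int.
Proof. by rewrite /entry to_sintK //=; case: insub. Qed.

(** The boolean [c] treats weak and strict growth together. Between -1 and 1 the hypothesis bounds
    twice the first entry x, and [c <= x + x] gives [c <= x] because [c] is 0 or 1. *)
Lemma dominant_step N (i : iseq d N) (c : bool) (j : nat) :
    (forall k, c%:Z <= (i k : int) - (lft i k : int)) -> (j < d)%N ->
  c%:Z <= (entry i (to_sint d j.+1%:Z) : int) - (entry i (to_sint d j%:Z) : int).
Proof.
move=> dom jd; have := dom (Ordinal jd).
rewrite (entryS i (Ordinal jd)) /lft /lo /=; case: j jd => [|j] jd //=.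
rewrite to_sintN entry_opp sint_oppE (entryS i (Ordinal jd)) entry0; case: (c); lia.
Qed.

Lemma dominant_homo N (i : iseq d N) (x y : sint d) : dominant i ->
  (x : int) <= y -> (entry i x : int) <= entry i y.
Proof.
move=> /dominantP dom.
have step j : (j < d)%N -> (entry i (to_sint d j%:Z) : int) <= entry i (to_sint d j.+1%:Z).
  by move/(@dominant_step _ i false); rewrite subr_ge0; apply=> k; rewrite subr_ge0.
have pos j l : (j + l <= d)%N ->
    (entry i (to_sint d j%:Z) : int) <= entry i (to_sint d (j + l)%:Z).
  elim: l => [|l IHl] ; first by rewrite addn0.
  by rewrite addnS => jl; apply: le_trans (step _ jl); apply: IHl; lia.
have pos' j l : (j <= l)%N -> (l <= d)%N ->
    (entry i (to_sint d j%:Z) : int) <= entry i (to_sint d l%:Z).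
  by move=> jl ld; have := pos j (l - j)%N; rewrite subnKC // => /(_ ld).
have := sint_le x; have := sint_le y.
rewrite -{3}(to_sint_val x) -{3}(to_sint_val y).
case: (x : int) => a; case: (y : int) => b /= bd ad xy; rewrite ?NegzE.
- exact: pos'.
- by lia.
- rewrite to_sintN entry_opp sint_oppE.
  have := pos' 0%N b; have := pos' 0%N a.+1; rewrite entry0; lia.
- rewrite !to_sintN !entry_opp !sint_oppE lerN2; apply: pos' => //; lia.
Qed.

(** By [lft_i0_neq] the growth is strict, and integers [0 < x_1 < .. < x_d <= d] must be
    [1, .., d]. *)
Lemma dominant_i0 w : dominant (wact i0 w) -> w = 1%g.
Proof.
move=> /dominantP dom; apply: wact_i0_inj; rewrite wact1.
have step j : (j < d)%N -> (entry (wact i0 w) (to_sint d j%:Z) : int) + 1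
    <= entry (wact i0 w) (to_sint d j.+1%:Z).
  have h k : true%:Z <= (wact i0 w k : int) - (lft (wact i0 w) k : int).
    by have := dom k; have := lft_i0_neq w k; lia.
  by move/(dominant_step h); lia.
have pos j l : (j + l <= d)%N ->
    (entry (wact i0 w) (to_sint d j%:Z) : int) + l%:Z
       <= entry (wact i0 w) (to_sint d (j + l)%:Z).
  elim: l => [|l IHl]; first by rewrite addn0 addr0.
  rewrite addnS => jl; have := step _ jl; have := IHl (ltnW jl); lia.
apply/ffunP=> k; rewrite [in RHS]ffunE; apply: sint_eqP; rewrite hiE -entryS.
have kd := ltn_ord k.
have := pos 0%N k.+1 kd; rewrite entry0 add0n.
have := pos k.+1 (d - k.+1)%N; rewrite subnKC // => /(_ (leqnn d)).
have := sint_le (entry (wact i0 w) (to_sint d d%:Z)); lia.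
Qed.

Let sgens : {set weyl d} := [set sgen j | j : 'I_d].

Lemma invs_i0 : invs i0 = 0%N.
Proof.
rewrite /invs /stat big1 ?big1 // => [k|[p r]] _ /=; rewrite !ffunE !hiE //.
by case: (ltnP p r) => // pr; have -> : (r.+1%:Z < p.+1%:Z) = false by lia.
Qed.

Lemma invs_i0_eq0 w : invs (wact i0 w) = 0%N -> w = 1%g.
Proof.
move=> e; apply: dominant_i0; apply: contraT => /ndominantP[k /invs_desc].
by rewrite e.
Qed.

Lemma invs_desc_ex w : (0 < invs (wact i0 w))%N ->
  exists k, (wact i0 w k : int) < lft (wact i0 w) k.
Proof.
move=> w0; apply/ndominantP; apply: contraTN w0 => /dominant_i0 ->.
by rewrite wact1 invs_i0.
Qed.

Lemma invs_i0_le n w : w \in (sgens ^+ n)%g -> (invs (wact i0 w) <= n)%N.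
Proof.
elim: n w => [|n IHn] w; first by rewrite expg0 inE => /eqP->; rewrite wact1 invs_i0.
rewrite expgSr => /mulsgP[u _ /IHn un /imsetP[k _ ->] ->]; rewrite wactM.
have := lft_i0_neq u k; rewrite neq_lt => /orP[/invs_asc->//|/invs_desc e].
by move: un; rewrite e; lia.
Qed.

Lemma invs_i0_mem w : w \in (sgens ^+ invs (wact i0 w))%g.
Proof.
move en : (invs _) => n; elim: n w en => [|n IHn] w en.
  by rewrite (invs_i0_eq0 en) expg0 inE.
have [|k lt] := @invs_desc_ex w; first by rewrite en.
rewrite expgSr -(mulgsK w k) mem_mulg ?imset_f //.
by apply: IHn; move: (invs_desc lt); rewrite en wactM => -[].
Qed.

Lemma invs_i0_surj w n : (n <= invs (wact i0 w))%N -> exists u, invs (wact i0 u) = n.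
Proof.
move e : (invs _) => l; elim: l w e => [|l IHl] w e.
  by rewrite leqn0 => /eqP->; exists w.
rewrite leq_eqVlt => /predU1P[->|nl]; first by exists w.
have [|k lt] := @invs_desc_ex w; first by rewrite e.
apply: (IHl (w * sgen k)%g) => //.
by move: (invs_desc lt); rewrite e wactM => -[].
Qed.

(** Each letter of a word raises the inversion count by at most one, and stripping descents produces
    a word with exactly that many letters. *)
Lemma lenE w : len w = invs (wact i0 w).
Proof.
(* [len] searches only below the order of the group. All counts from 0 to that of [w] are attained,
   necessarily by distinct elements, so the search succeeds. *)
have lt : (invs (wact i0 w) < #|weyl d|)%N.
  rewrite cardE -(size_map (fun u => invs (wact i0 u))) -(size_iota 0 (_.+1)).
  apply: uniq_leq_size (iota_uniq _ _) _ => n; rewrite mem_iota /= ltnS.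
  by case/invs_i0_surj=> u <-; apply: map_f; rewrite mem_enum.
apply/eqP; rewrite eqn_leq /len; apply/andP; split.
  rewrite leqNgt; apply/negP => /(before_find 0%N).
  by rewrite nth_iota // add0n invs_i0_mem.
set a := fun k : nat => _; have : has a (iota 0 #|weyl d|).
  by apply/hasP; exists (invs (wact i0 w)); rewrite ?mem_iota //; exact: invs_i0_mem.
move=> h; have := nth_find 0%N h; rewrite nth_iota ?add0n; first exact: invs_i0_le.
by rewrite -[ltnRHS](size_iota 0) -has_find.
Qed.

Lemma len_asc w k : (lft (wact i0 w) k : int) < wact i0 w k ->
  len (w * sgen k)%g = (len w).+1.
Proof. by rewrite !lenE wactM; exact: invs_asc. Qed.

Lemma len_desc w k : (wact i0 w k : int) < lft (wact i0 w) k ->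
  len w = (len (w * sgen k)%g).+1.
Proof. by rewrite !lenE wactM; exact: invs_desc. Qed.

Lemma len1 : len (1%g : weyl d) = 0%N.
Proof. by rewrite lenE wact1 invs_i0. Qed.

Lemma len_eq0 w : len w = 0%N -> w = 1%g.
Proof. by rewrite lenE; exact: invs_i0_eq0. Qed.

Lemma len_sgen k : len (sgen k) = 1%N.
Proof.
by rewrite -[sgen k]mul1g len_asc ?len1 // wact1 /lft entry_i0 ffunE loE hiE; case: eqP; lia.
Qed.

End Length.

(** * Stabilisers and shortest coset representatives *)

Section Cosets.
Variable d : nat.
Implicit Types (w u g : weyl d) (k : 'I_d) (J : {set 'I_d}).

Lemma len_asc_inv w k : len (w * sgen k)%g = (len w).+1 ->
  (lft (wact (i0 d) w) k : int) < wact (i0 d) w k.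
Proof.
move=> e; have := lft_i0_neq w k; rewrite neq_lt => /orP[//|/len_desc]; lia.
Qed.

Definition eqgens N (i : iseq d N) : {set 'I_d} := [set k | lft i k == i k].

Lemma eqgensP N (i : iseq d N) k : reflect (lft i k = i k) (k \in eqgens i).
Proof. by rewrite inE; exact: eqP. Qed.

(* A descent of u sits at two entries that i cannot separate. *)
Lemma stab_ind N (i : iseq d N) (P : weyl d -> Prop) : dominant i -> P 1%g ->
    (forall u k, wact i u = i -> k \in eqgens i ->
       len (u * sgen k)%g = (len u).+1 -> P u -> P (u * sgen k)%g) ->
  forall u, wact i u = i -> P u.
Proof.
move=> dom P1 PS u; move en : (len u) => n.
elim: n u en => [|n IHn] u en iu; first by rewrite (len_eq0 en).
have [|k lt] := @invs_desc_ex _ u; first by rewrite -lenE en.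
have ek : lft i k = i k.
  apply: sint_eqP; have /dominantP/(_ k) := dom.
  have := dominant_homo dom (ltW lt); rewrite -wact_entry -lft_entry iu; lia.
have iuk : wact i (u * sgen k) = i by rewrite wactM iu wact_sgen_id.
have lk := len_desc lt.
rewrite -(mulgsK u k); apply: PS => //; first exact/eqgensP.
  by rewrite mulgsK.
by apply: IHn => //; move: lk; rewrite en => -[].
Qed.

(** Turns membership in a parabolic subgroup into a test on a single sequence. *)
Lemma stab_parabolic N (i : iseq d N) u : dominant i ->
  (u \in parabolic (eqgens i)) = (wact i u == i).
Proof.
move=> dom; have stab_group : group_set [set w | wact i w == i].
  apply/group_setP; split; first by rewrite inE wact1.
  by move=> x y; rewrite !inE wactM => /eqP-> /eqP->.
apply/idP/eqP => [|].
  suff /subsetP sub : parabolic (eqgens i) \subset [set w | wact i w == i].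
    by move/sub; rewrite inE => /eqP.
  rewrite (gen_subG _ (Group stab_group)); apply/subsetP=> _ /imsetP[k /eqgensP ek ->].
  by rewrite inE wact_sgen_id.
move: u; apply: (stab_ind dom); first exact: group1.
by move=> w k _ ki _ wi; rewrite groupM // mem_gen // imset_f.
Qed.

(** Every parabolic subgroup is thereby a stabiliser, so [stab_ind] applies to it. The sequence
    starts from 0 and increases by one exactly at the positions outside [J]. *)
Lemma dominant_ex J : exists i : iseq d d, dominant i /\ eqgens i = J.
Proof.
pose c (k : nat) := #|[set j : 'I_d | (j <= k)%N && (j \notin J)]|.
have cd k : (c k <= d)%N by rewrite -[X in (_ <= X)%N](card_ord d) max_card.
pose i : iseq d d := [ffun k : 'I_d => to_sint d (c k)%:Z].
have iE k : i k = c k :> int by rewrite ffunE to_sintK //; exact: cd.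
have cS k : k != 0%N :> nat -> c k = ((k \notin J) + c k.-1)%N.
  move=> k0; rewrite /c (cardsD1 k) inE leqnn /=; congr addn.
  apply: eq_card => j; rewrite !inE -val_eqE /=.
  by case: (j \notin J); rewrite ?andbF ?andbT //; lia.
have c0 k : k = 0%N :> nat -> c k = (k \notin J).
  move=> k0; rewrite /c (cardsD1 k) inE leqnn /= -[RHS]addn0; congr addn.
  apply/eqP; rewrite cards_eq0; apply/eqP/setP=> j; rewrite !inE -val_eqE /=.
  by case: (j \notin J); rewrite ?andbF ?andbT //; lia.
exists i; split.
  apply/dominantP=> k; case: (eqVneq (k : nat) 0%N) => k0.
    by rewrite lft0 // sint_oppE iE; lia.
  by rewrite lftS // !iE ord_predE // (cS k); lia.
apply/setP=> k; rewrite inE sint_eqE; case: (eqVneq (k : nat) 0%N) => k0.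
  by rewrite lft0 // sint_oppE iE c0 //; case: (k \in J).
by rewrite lftS // !iE ord_predE // (cS k) //; case: (k \in J); lia.
Qed.

Lemma parabolic_ind J (P : weyl d -> Prop) : P 1%g ->
    (forall u k, u \in parabolic J -> k \in J ->
       len (u * sgen k)%g = (len u).+1 -> P u -> P (u * sgen k)%g) ->
  forall u, u \in parabolic J -> P u.
Proof.
have [i [dom <-]] := dominant_ex J => P1 PS u; rewrite stab_parabolic // => /eqP.
move: u; apply: (stab_ind dom) => // w k wi; apply: PS.
by rewrite stab_parabolic // wi.
Qed.

(** This is [stab_ind] for the unique sequence with [N = 0], whose stabiliser is the whole group. *)
Lemma len_ind (P : weyl d -> Prop) : P 1%g ->
    (forall w k, len (w * sgen k)%g = (len w).+1 -> P w -> P (w * sgen k)%g) ->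
  forall w, P w.
Proof.
move=> P1 PS w; pose i : iseq d 0 := [ffun=> sint0 0].
have sint00 (a b : sint 0) : a = b.
  by apply: sint_eqP; have := sint_le a; have := sint_le b; lia.
have dom : dominant i by apply/dominantP=> k; rewrite (sint00 (lft i k) (i k)).
apply: (stab_ind dom P1); last by apply/ffunP.
by move=> u k _ _; apply: PS.
Qed.

(** Additivity over the stabiliser replaces minimality in the coset, because it propagates along
    ascents; [minrep_D] shows that the two agree for [i_ mu]. *)
Definition minrep N (i : iseq d N) g :=
  forall u, wact i u = i -> len (u * g)%g = (len u + len g)%N.

Lemma minrep1 N (i : iseq d N) : minrep i 1%g.
Proof. by move=> u _; rewrite mulg1 len1 addn0. Qed.

Lemma minrep_asc N (i : iseq d N) g k : dominant i -> minrep i g ->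
    (lft (wact i g) k : int) < wact i g k ->
  minrep i (g * sgen k)%g /\ len (g * sgen k)%g = (len g).+1.
Proof.
move=> dom mg lt.
have asc u : wact i u = i -> len (u * g * sgen k)%g = (len u + len g).+1.
  (* By [dominant_homo], a descent of the regular sequence at [u * g] would be a weak descent of
     [wact i g]. *)
  move=> iu; rewrite -mg // len_asc // ltNge; apply: contraL lt => /(dominant_homo dom).
  by rewrite -wact_entry -lft_entry wactM iu -leNgt.
have e : len (g * sgen k)%g = (len g).+1.
  by have := asc 1%g (wact1 i); rewrite mul1g len1.
by split=> // u iu; rewrite mulgA asc // e addnS.
Qed.

Lemma minrep_desc N (i : iseq d N) g k : dominant i -> minrep i g ->
  (wact i g k : int) < lft (wact i g) k -> minrep i (g * sgen k)%g.
Proof.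
move=> dom mg lt.
have desc u : wact i u = i -> (len u + len g)%N = (len (u * g * sgen k)%g).+1.
  move=> iu; rewrite -mg // -len_desc // ltNge; apply: contraL lt => /(dominant_homo dom).
  by rewrite -wact_entry -lft_entry wactM iu -leNgt.
have e : len g = (len (g * sgen k)%g).+1.
  by have := desc 1%g (wact1 i); rewrite mul1g len1.
by move=> u iu; have := desc u iu; rewrite mulgA e addnS => -[].
Qed.

(* Here g * sgen k = u * g with u in the stabiliser, and comparing lengths    *)
(* leaves only len u = 1.                                                     *)
Lemma minrep_eq N (i : iseq d N) g k : minrep i g ->
    lft (wact i g) k = wact i g k ->
  exists2 j, j \in eqgens i & (g * sgen k = sgen j * g)%g.
Proof.
move=> mg e; pose u := (g * sgen k * g^-1)%g.
have ug : (g * sgen k = u * g)%g by rewrite mulgKV.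
have iu : wact i u = i.
  by rewrite 2!wactM wact_sgen_id // -wactM mulgV wact1.
have u0 : (0 < len u)%N.
  rewrite lt0n; apply/eqP => /len_eq0 u1; have := sgen_neq1 k.
  by move: ug; rewrite u1 mul1g -[RHS]mulg1 => /mulgI ->; rewrite eqxx.
have u1 : len u = 1%N.
  have := mg u iu; rewrite -ug; have := lft_i0_neq g k.
  by rewrite neq_lt => /orP[/len_asc|/len_desc]; lia.
have [|j lt] := @invs_desc_ex _ u; first by rewrite -lenE.
have {lt} uj : u = sgen j.
  rewrite -(mulgsK u j) [X in (X * _)%g]len_eq0 ?mul1g //.
  by have := len_desc lt; rewrite u1 => -[].
exists j; last by rewrite -uj.
by apply/eqgensP; rewrite -wact_sgen_hi -uj iu.
Qed.

(** Follows a word for [w]: a letter at unequal entries multiplies [g], a letter at equal entries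
    acts trivially and is dropped. *)
Lemma minrep_ex N (i : iseq d N) w : dominant i ->
  exists2 g, minrep i g & wact i g = wact i w.
Proof.
move=> dom; move: w; apply: len_ind => [|w k _ [g mg gw]]; first by exists 1%g; first exact: minrep1.
have [e|] := eqVneq (lft (wact i g) k) (wact i g k).
  by exists g; rewrite // wactM -gw wact_sgen_id.
move=> e; exists (g * sgen k)%g; last by rewrite !wactM gw.
move: e; rewrite sint_eqE neq_lt => /orP[/(minrep_asc dom mg)[//]|].
exact: minrep_desc.
Qed.

(** Additivity for both [u * h = g] and [u^-1 * g = h] leaves no length for [u]. *)
Lemma minrep_uniq N (i : iseq d N) g h :
  minrep i g -> minrep i h -> wact i g = wact i h -> g = h.
Proof.
move=> mg mh e; pose u := (g * h^-1)%g.
have iu : wact i u = i by rewrite wactM e -wactM mulgV wact1.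
have iuV : wact i u^-1 = i by rewrite -{1}iu -wactM mulgV wact1.
have := mg _ iuV; have := mh _ iu; rewrite invMg invgK !mulgKV => -> lh.
have /len_eq0 u1 : len u = 0%N by lia.
by rewrite -(mulgKV h g) -/u u1 mul1g.
Qed.

(** If the representative [g] had a descent, dominance of both sequences would force equal entries
    there, and [minrep_eq] would make the length go up instead. *)
Lemma dominant_orbit N (i : iseq d N) w :
  dominant i -> dominant (wact i w) -> wact i w = i.
Proof.
move=> dom; have [g mg <-] := minrep_ex w dom => domg.
case: (posnP (len g)) => [/len_eq0->|g0]; first by rewrite wact1.
have [|k lt] := @invs_desc_ex _ g; first by rewrite -lenE.
have ek : lft (wact i g) k = wact i g k.
  apply: sint_eqP; have /dominantP/(_ k) := domg.
  have := dominant_homo dom (ltW lt); rewrite -wact_entry -lft_entry; lia.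
have [j /eqgensP ej gj] := minrep_eq mg ek.
by have := len_desc lt; rewrite gj mg ?wact_sgen_id // len_sgen; lia.
Qed.

Lemma dominant_rep_ex N (i' : iseq d N) :
  exists i, dominant i /\ exists2 g, minrep i g & wact i g = i'.
Proof.
suff [i [dom [w <-]]] : exists i, dominant i /\ exists w, wact i w = i'.
  by exists i; split=> //; exact: minrep_ex.
move en : (invs i') => n; elim: n i' en => [|n IHn] i' en.
all: case: (boolP (dominant i')) => [dom|/ndominantP[k /invs_desc]];
  first by exists i'; split=> //; exists 1%g; rewrite wact1.
all: rewrite en // => -[/esym/IHn[i [dom [w e]]]].
by exists i; split=> //; exists (w * sgen k)%g; rewrite wactM e wact_sgenK.
Qed.

Lemma sgen_fix k (x : sint d) : absz x != k -> absz x != k.+1 ->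
  sgval (sgen k) x = x.
Proof.
have kd := ltn_ord k; have := sint_le x.
rewrite /= /sgen_perm; case: ifPn => k0 xd x1 x2.
  by rewrite tpermD // -val_eqE /= to_sintK; lia.
rewrite permM (@tpermD _ (to_sint d k%:Z)) ?tpermD // -val_eqE /= to_sintK; lia.
Qed.

Lemma parabolic_fix J u (x : sint d) : u \in parabolic J ->
  (forall k, k \in J -> (absz x != k) && (absz x != k.+1)) -> sgval u x = x.
Proof.
move=> uJ xJ; move: u uJ; apply: parabolic_ind => [|w k _ kJ _ IH]; first by rewrite perm1.
by rewrite permM IH; have /andP[] := xJ k kJ; exact: sgen_fix.
Qed.

(** * Commuting parabolic subgroups with separated supports *)

Section Split.
Variables (M : nat) (J0 J1 : {set 'I_d}).
Hypothesis J0M : forall k, k \in J0 -> (k < M)%N.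
Hypothesis J1M : forall k, k \in J1 -> (M < k)%N.

Lemma fix0 u (x : sint d) : u \in parabolic J0 -> (M < absz x)%N -> sgval u x = x.
Proof. by move/parabolic_fix=> h xM; apply: h => k /J0M; lia. Qed.

Lemma fix1 u (x : sint d) : u \in parabolic J1 -> (absz x <= M)%N -> sgval u x = x.
Proof. by move/parabolic_fix=> h xM; apply: h => k /J1M; lia. Qed.

Lemma split_comm u0 u1 : u0 \in parabolic J0 -> u1 \in parabolic J1 ->
  (u0 * u1 = u1 * u0)%g.
Proof.
move=> h0 h1; apply: val_inj; apply/permP=> x; rewrite /= !permM.
case: (leqP (absz x) M) => xM.
  rewrite (fix1 h1 xM); case: (leqP (absz (sgval u0 x)) M) => yM.
    by rewrite (fix1 h1 yM).
  by rewrite (perm_inj (fix0 h0 yM)) (fix1 h1 xM).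
rewrite (fix0 h0 xM); case: (leqP (absz (sgval u1 x)) M) => yM.
  by rewrite (perm_inj (fix1 h1 yM)) (fix0 h0 xM).
by rewrite (fix0 h0 yM).
Qed.

(** Beyond [M] the inverses of [u0 * u] and [u] agree, so an ascent of [u] at a generator from [J1]
    is still an ascent of [u0 * u]. *)
Lemma split_len u0 u1 : u0 \in parabolic J0 -> u1 \in parabolic J1 ->
  len (u0 * u1)%g = (len u0 + len u1)%N.
Proof.
move=> h0; move: u1; apply: parabolic_ind => [|u k uJ kJ lu IH]; first by rewrite mulg1 len1 addn0.
rewrite lu addnS -IH mulgA len_asc //.
have inv_fix (x : sint d) : (M < absz x)%N ->
    (sgval (u0 * u)%g)^-1%g x = (sgval u)^-1%g x.
  move=> xM; rewrite /= invMg permM.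
  case: (leqP (absz ((sgval u)^-1%g x)) M) => [yM|yM].
    by move: (fix1 uJ yM) xM; rewrite permKV => {1}->; rewrite ltnNge yM.
  by rewrite -[in LHS](fix0 h0 yM) permK.
have := len_asc_inv lu; rewrite !lft_i0 !wact_i0 !inv_fix ?loE ?hiE //.
  by have := J1M kJ; lia.
by have := J1M kJ; case: eqP; lia.
Qed.

End Split.
End Cosets.

(** * The sequences i_ mu *)

Lemma count_leq_path0 (s : seq nat) b x : path leq x s -> (b < x)%N ->
  count (leq^~ b) s = 0%N.
Proof.
move=> /(order_path_min leq_trans)/allP sx bx; apply/eqP; rewrite -leqn0 leqNgt -has_count.
by apply/hasPn=> y /sx xy; rewrite -ltnNge (leq_trans bx).
Qed.

Lemma nth_sorted_le (s : seq nat) b k : sorted leq s -> (k < size s)%N ->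
  (nth 0%N s k <= b)%N = (k < count (leq^~ b) s)%N.
Proof.
elim: s k => [|x s IHs] [|k] //= px ks; case: (leqP x b) => xb.
- by [].
- by rewrite (count_leq_path0 px xb).
- by rewrite add1n ltnS IHs ?(path_sorted px).
- rewrite (count_leq_path0 px xb); apply/negbTE; rewrite -ltnNge (leq_trans xb) //.
  by have /allP := order_path_min leq_trans px; apply; apply: mem_nth.
Qed.

Section Weights.
Variables m n d : nat.
Implicit Types (mu : weight m n d) (k l : 'I_d).

Definition wseq mu : seq nat := flatten
  [seq nseq (val mu a) (a : nat) | a <- enum 'I_(m + n).+1].

Lemma count_wseq (P : pred nat) mu :
  count P (wseq mu) = (\sum_(a < (m + n).+1 | P a) val mu a)%N.
Proof.
rewrite count_flatten sumnE 2!big_map big_enum [RHS]big_mkcond /=.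
by apply: eq_bigr => a _; rewrite count_nseq; case: (P a); rewrite ?mul1n ?mul0n.
Qed.

Lemma size_wseq mu : size (wseq mu) = d.
Proof. by rewrite -count_predT count_wseq (eqP (valP mu)). Qed.

Lemma wseq_sorted mu : sorted leq (wseq mu).
Proof.
have: pairwise leq [seq val a | a <- enum 'I_(m + n).+1].
  by rewrite val_enum_ord -(sorted_pairwise leq_trans) iota_sorted.
rewrite /wseq (sorted_pairwise leq_trans); elim: (enum _) => //= a l IHl /andP[al pl].
rewrite pairwise_cat IHl // andbT; apply/andP; split; last first.
  by elim: (nat_of_ord (val mu a)) => //= c ->; rewrite andbT; apply/allP => y /nseqP[->].
apply/allrelP=> x y /nseqP[-> _] /flattenP[s /mapP[b bl ->] /nseqP[-> _]].
by apply: (allP al); exact: map_f.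
Qed.

Lemma nth_wseq mu k : (nth 0 (wseq mu) k <= m + n)%N.
Proof.
have: nth 0%N (wseq mu) k \in wseq mu by rewrite mem_nth ?size_wseq.
by case/flattenP=> s /mapP[b bl ->] /nseqP[-> _]; rewrite -ltnS.
Qed.

Lemma i_E mu k : i_ mu k = nth 0%N (wseq mu) k :> int.
Proof. by rewrite ffunE to_sintK //; exact: nth_wseq. Qed.

Lemma i_le mu k (b : nat) : ((i_ mu k : int) <= b%:Z) = (k < lam_sum mu b)%N.
Proof.
by rewrite i_E lez_nat nth_sorted_le ?wseq_sorted ?size_wseq // count_wseq.
Qed.

Lemma i_ge0 mu k : 0 <= (i_ mu k : int).
Proof. by rewrite i_E. Qed.

Lemma i_bound mu k : (i_ mu k : int) <= (m + n)%:Z.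
Proof. by rewrite i_E lez_nat nth_wseq. Qed.

Lemma dominant_i_ mu : dominant (i_ mu).
Proof.
apply/dominantP=> k; case: (eqVneq (k : nat) 0%N) => k0.
  by rewrite lft0 // sint_oppE; have := i_ge0 mu k; lia.
rewrite lftS // [X in _ <= X]i_E i_le ord_predE //.
by apply: leq_ltn_trans (leq_pred k) _; rewrite -i_le i_E.
Qed.

(** A generator moves [i_ mu] exactly where the sequence jumps, that is, at the partial sums of
    [mu]. *)
Lemma eqgens_i_ mu : eqgens (i_ mu) = J_ mu.
Proof.
apply/setP=> k; apply/eqgensP/idP => [e|]; rewrite inE.
  apply/forallP=> j; apply/eqP=> kj.
  have := i_le mu k j; rewrite -kj ltnn => ikj.
  case: (eqVneq (k : nat) 0%N) => k0; move: e.
    by rewrite lft0 // => /(congr1 (@sint_val _)); rewrite sint_oppE; have := i_ge0 mu k; lia.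
  rewrite lftS // => e; move: ikj; rewrite -e i_le -kj ord_predE //; lia.
move=> /forallP kJ; apply: sint_eqP.
have := dominantP _ (dominant_i_ mu) k; rewrite le_eqVlt => /orP[/eqP//|lt].
have ib := i_bound mu k.
case: (eqVneq (k : nat) 0%N) => k0; move: lt.
  rewrite lft0 // sint_oppE => lt.
  have mn0 : (0 < m + n)%N by lia.
  have := kJ (Ordinal mn0); have := i_le mu k 0; rewrite /= k0; lia.
rewrite lftS // => lt.
(* If a is the entry before the jump, then [k] is the partial sum at a; and [a < m + n] because a
   larger entry follows. *)
have := i_ge0 mu (ord_pred k); have := i_le mu (ord_pred k) (absz (i_ mu (ord_pred k))).
have := i_le mu k (absz (i_ mu (ord_pred k))); rewrite ord_predE // => h1 h2 ige.
have jlt : (absz (i_ mu (ord_pred k)) < m + n)%N by lia.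
by have := kJ (Ordinal jlt); rewrite /=; lia.
Qed.

Lemma dominant_le N (i : iseq d N) k l : dominant i -> (k <= l)%N -> (i k : int) <= i l.
Proof. by move=> dom kl; rewrite -!entry_hi dominant_homo // !hiE. Qed.

Lemma dominant_ge0 N (i : iseq d N) k : dominant i -> 0 <= (i k : int).
Proof.
move=> dom; have := @dominant_homo _ _ i (to_sint d 0) (hi k) dom.
by rewrite entry0 entry_hi hiE to_sintK //; apply.
Qed.

(** [mu] counts the entries of each value. Both sequences are weakly increasing, so their sublevel
    sets are initial segments, and these have the same sizes. *)
Lemma dominant_weight (i : iseq d (m + n)) : dominant i -> exists mu, i_ mu = i.
Proof.
move=> dom; pose c (a : 'I_(m + n).+1) := #|[set k | absz (i k) == a]|.
have cd a : (c a < d.+1)%N by rewrite ltnS -[X in (_ <= X)%N](card_ord d) max_card.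
pose lam : {ffun 'I_(m + n).+1 -> 'I_d.+1} := [ffun a => Ordinal (cd a)].
have sumE (P : pred nat) :
    (\sum_(a < (m + n).+1 | P a) lam a = #|[set k | P (absz (i k))]|)%N.
  under eq_bigr => a _.
    rewrite ffunE /= /c -sum1_card big_mkcond; under eq_bigr => k _ do rewrite inE.
    over.
  rewrite exchange_big /= -sum1_card [RHS]big_mkcond; apply: eq_bigr => k _.
  have ik : (absz (i k) < (m + n).+1)%N by rewrite ltnS sint_le.
  rewrite inE -big_mkcondr /=.
  under eq_bigl => a do rewrite andbC eq_sym -[X in _ == X]/(nat_of_ord (Ordinal ik)) val_eqE.
  rewrite big_mkcondr big_pred1_eq /=; by [].
have lamP : (\sum_a lam a == d)%N.
  by rewrite (sumE predT) /= -[X in _ == X](card_ord d) cardsT.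
pose mu : weight m n d := exist _ lam lamP.
have lE b : lam_sum mu b = #|[set k | (absz (i k) <= b)%N]| by exact: sumE (leq^~ b).
exists mu; apply/ffunP=> k; apply: sint_eqP; apply/eqP; rewrite eq_le.
have ik0 := dominant_ge0 k dom.
have cmp b : ((i_ mu k : int) <= b%:Z) = ((i k : int) <= b%:Z).
  rewrite i_le lE; case: (leP (i k : int) b%:Z) => ikb.
    apply: (@leq_trans #|[set l : 'I_d | (l < k.+1)%N]|); last first.
      apply: subset_leq_card; apply/subsetP=> l; rewrite !inE ltnS => lk.
      by have := dominant_le dom lk; have := dominant_ge0 l dom; lia.
    by rewrite -sum1dep_card (big_ord_narrow (ltn_ord k)) big_const_ord iter_addn_0 mul1n.
  apply/negbTE; rewrite -leqNgt.
  apply: (@leq_trans #|[set l : 'I_d | (l < k)%N]|).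
    apply: subset_leq_card; apply/subsetP=> l; rewrite !inE => lb.
    rewrite ltnNge; apply/negP=> /(dominant_le dom); have := dominant_ge0 l dom; lia.
  by rewrite -sum1dep_card (big_ord_narrow (ltnW (ltn_ord k))) big_const_ord iter_addn_0 mul1n.
have := cmp (absz (i k)); rewrite gez0_abs // lexx => ->.
by have := cmp (absz (i_ mu k)); rewrite gez0_abs ?i_ge0 // lexx => <-.
Qed.

Lemma i_inj : injective (@i_ m n d).
Proof.
move=> mu nu e; have es : wseq mu = wseq nu.
  apply: (eq_from_nth (x0 := 0%N)); rewrite !size_wseq // => k kd.
  have /ffunP/(_ (Ordinal kd))/(congr1 (@sint_val _)) := e.
  by rewrite !i_E => -[].
apply: val_inj; apply/ffunP=> a; apply: val_inj => /=.
have := count_wseq (pred1 (a : nat)) mu; rewrite es count_wseq /=.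
by rewrite !big_pred1_eq.
Qed.

Lemma parity_i_ mu (x : sint d) :
  parity m n (entry (i_ mu) x) = (lam_sum mu m < absz x)%N.
Proof.
have pos (k : 'I_d) : (m < absz (i_ mu k))%N = (lam_sum mu m < k.+1)%N.
  by have := i_le mu k m; have := i_ge0 mu k; lia.
rewrite -{1}(to_sint_val x) /parity; have := sint_le x.
case: (x : int) => [[|k]|k] kd.
- by rewrite entry0.
- by rewrite (entryS _ (Ordinal kd)) pos.
- by rewrite NegzE (entryN _ (Ordinal kd)) sint_oppE !abszN pos.
Qed.

(** For the forward direction, write [g = u * h] with [h] additive and [u] in the stabiliser;
    minimality of [g] against [u^-1 * g = h] forces [u = 1]. *)
Lemma minrep_D mu g : (g \in D_ mu) <-> minrep (i_ mu) g.
Proof.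
have dom := dominant_i_ mu.
rewrite inE -eqgens_i_; split=> [/forall_inP gD|mg]; last first.
  by apply/forall_inP=> u; rewrite stab_parabolic // => /eqP/mg ->; rewrite leq_addl.
have [h mh e] := minrep_ex g dom; pose u := (g * h^-1)%g.
have iu : wact (i_ mu) u = i_ mu by rewrite wactM -e -wactM mulgV wact1.
have uV : (u^-1)%g \in parabolic (eqgens (i_ mu)).
  by rewrite groupV stab_parabolic // iu.
have := gD _ uV; rewrite invMg invgK mulgKV.
have := mh _ iu; rewrite mulgKV => -> lu.
have /len_eq0 u1 : len u = 0%N by lia.
by rewrite -(mulgKV h g) -/u u1 mul1g.
Qed.

Lemma rep_ex (i : iseq d (m + n)) :
  exists p : weight m n d * weyl d, (p.2 \in D_ p.1) && (wact (i_ p.1) p.2 == i).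
Proof.
have [i' [/dominant_weight[mu <-] [g mg gi]]] := dominant_rep_ex i.
by exists (mu, g); rewrite gi eqxx andbT; apply/minrep_D.
Qed.

Lemma rep_uniq mu nu g h : g \in D_ mu -> h \in D_ nu ->
  wact (i_ mu) g = wact (i_ nu) h -> mu = nu /\ g = h.
Proof.
move=> /minrep_D mg /minrep_D mh e.
have en : wact (i_ mu) (g * h^-1) = i_ nu by rewrite wactM e -wactM mulgV wact1.
have /i_inj mn : i_ mu = i_ nu.
  by rewrite -en [RHS]dominant_orbit ?en ?dominant_i_.
by split=> //; rewrite mn in mg e *; apply: minrep_uniq mg mh e.
Qed.

Lemma J0_lt mu k : k \in J0_ mu -> (k < lam_sum mu m)%N.
Proof. by rewrite inE => /andP[]. Qed.

Lemma J1_gt mu k : k \in J1_ mu -> (lam_sum mu m < k)%N.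
Proof. by rewrite inE => /andP[]. Qed.

Lemma J_split mu k : k \in J_ mu -> (k \in J0_ mu) || (k \in J1_ mu).
Proof.
move=> kJ; rewrite [k \in J0_ _]inE [k \in J1_ _]inE kJ /= -neq_ltn; move: kJ; rewrite inE => /forallP kJ.
(* [m] is among the indices excluded in [J_] only when [0 < n]; for [n = 0] the partial sum at [m]
   is [d], beyond every [k]. *)
case: (posnP n) => [n0|n0]; last first.
  have mn : (m < m + n)%N by lia.
  exact: (kJ (Ordinal mn)).
have -> : lam_sum mu m = d; last by rewrite neq_ltn ltn_ord.
rewrite /lam_sum -[RHS](eqP (valP mu)); apply: eq_bigl => a.
by have := ltn_ord a; lia.
Qed.

End Weights.

(** * The Hecke algebra *)

Lemma q_unit : q \is a GRing.unit.
Proof. by rewrite unitrX // v_unit. Qed.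

Lemma Nq_unit : - q \is a GRing.unit.
Proof. by rewrite unitrN q_unit. Qed.

Section Hecke.
Variables (d : nat) (H : algType laurent) (T : weyl d -> H).
Hypothesis hT : is_hecke T.
Implicit Types (w u g : weyl d) (k : 'I_d).

Lemma hecke_span h : exists c : weyl d -> laurent, h = \sum_w c w *: T w.
Proof. by have [/(_ h)[c [e _]] _ _] := hT; exists c. Qed.

Lemma hecke_free (c : weyl d -> laurent) : \sum_w c w *: T w = 0 -> forall w, c w = 0.
Proof.
move=> c0 w; have [/(_ 0)[b [_ ub]] _ _] := hT.
have b0 : b = [ffun=> 0].
  by apply: ub; rewrite big1 // => u _; rewrite ffunE scale0r.
have bc : b = [ffun u => c u].
  by apply: ub; rewrite -[LHS]c0; apply: eq_bigr => u _; rewrite ffunE.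
by have /ffunP/(_ w) := bc; rewrite b0 !ffunE.
Qed.

Lemma hecke_free_fam (I : finType) (P : pred I) (a : I -> laurent) (f : I -> weyl d) :
  \sum_(t | P t) a t *: T (f t) = 0 ->
  forall w, \sum_(t | P t && (f t == w)) a t = 0.
Proof.
rewrite (partition_big f predT) //= => e; apply: hecke_free; rewrite -[RHS]e.
apply: eq_bigr => w _; rewrite scaler_suml; apply: eq_bigr => t /andP[_ /eqP->] //.
Qed.

Lemma T_mul w u : len (w * u)%g = (len w + len u)%N -> T w * T u = T (w * u)%g.
Proof. by have [_ h _] := hT; apply: h. Qed.

(** [T 1] is a left identity for each [T w], hence for their span, which contains 1. *)
Lemma T1 : T 1%g = 1.
Proof.
have [c e] := hecke_span 1; rewrite -[LHS]mulr1 {1}e mulr_sumr [RHS]e.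
apply: eq_bigr => w _; rewrite -scalerAr T_mul mul1g ?len1 //.
Qed.

Lemma T_sq k : T (sgen k) * T (sgen k) = q *: 1 + (q - 1) *: T (sgen k).
Proof.
have [_ _ /(_ k)] := hT; rewrite mulrDl mul1r mulrBr -scalerAr mulr1 => e.
move/eqP: e; rewrite addr_eq0 subr_eq => /eqP ->.
by rewrite opprB -addrA scalerBl scale1r [- _ + _]addrC.
Qed.

Lemma T_asc w k : len (w * sgen k)%g = (len w).+1 ->
  T w * T (sgen k) = T (w * sgen k)%g.
Proof. by move=> e; rewrite T_mul // e len_sgen addn1. Qed.

Lemma T_desc w k : len w = (len (w * sgen k)%g).+1 ->
  T w * T (sgen k) = q *: T (w * sgen k)%g + (q - 1) *: T w.
Proof.
move=> e; have wk : T w = T (w * sgen k)%g * T (sgen k) by rewrite T_asc mulgsK.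
by rewrite {1}wk -mulrA T_sq mulrDr -!scalerAr mulr1 -wk.
Qed.

Lemma len_cases w k : len (w * sgen k)%g = (len w).+1 \/
  len w = (len (w * sgen k)%g).+1.
Proof.
have := lft_i0_neq w k.
by rewrite neq_lt => /orP[/len_asc|/len_desc]; [left | right].
Qed.

(* The hypotheses on kappa and lam make T w + kappa *: T (w * sgen k), for     *)
(* len (w * sgen k) = (len w).+1, an eigenvector of right multiplication by   *)
(* T (sgen k).                                                                *)
Lemma sum_T_sgen (A : {set weyl d}) (c : weyl d -> laurent) (kappa lam : laurent) k :
    (forall w, w \in A -> (w * sgen k)%g \in A) ->
    (forall w, w \in A -> len (w * sgen k)%g = (len w).+1 ->
       c (w * sgen k)%g = kappa * c w) ->
    kappa * q = lam -> 1 + kappa * (q - 1) = lam * kappa ->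
  (\sum_(w in A) c w *: T w) * T (sgen k) = lam *: \sum_(w in A) c w *: T w.
Proof.
move=> Ak ck e1 e2; pose asc w := len (w * sgen k)%g == (len w).+1.
have AkE w : ((w * sgen k)%g \in A) = (w \in A).
  by apply/idP/idP => /Ak //; rewrite mulgsK.
have pairs (f : weyl d -> H) :
    \sum_(w in A) f w = \sum_(w in A | asc w) (f w + f (w * sgen k)%g).
  rewrite (bigID asc) /= big_split /=; congr (_ + _).
  rewrite (reindex_inj (mulIg (sgen k))) /=; apply: eq_bigl => w.
  rewrite AkE /asc mulgsK; case: (w \in A) => //=.
  have flip (a b : nat) : b = a.+1 \/ a = b.+1 -> (a != b.+1) = (b == a.+1).
    by clear; lia.
  exact/flip/len_cases.
rewrite mulr_suml scaler_sumr !pairs; apply: eq_bigr => w /andP[wA /eqP aw].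
rewrite ck // -!scalerAl T_asc // T_desc ?mulgsK // !scalerA scalerDr !scalerA.
rewrite addrCA -scalerDl; congr (_ *: _ + _ *: _); first by rewrite -e1; ring.
by rewrite mulrA -e2; ring.
Qed.

End Hecke.

(** * The elements [xy]_mu and the independence of the [xy]_mu T_g *)

Section XY.
Variables (m n d : nat) (H : algType laurent) (T : weyl d -> H).
Hypothesis hT : is_hecke T.
Implicit Types (w u g : weyl d) (k : 'I_d) (mu : weight m n d).

Let X0 mu : H := \sum_(w in parabolic (J0_ mu)) T w.
Let X1 mu : H := \sum_(w in parabolic (J1_ mu)) (- q) ^- len w *: T w.

Lemma parabolic_sgen (J : {set 'I_d}) k w : k \in J -> w \in parabolic J ->
  (w * sgen k)%g \in parabolic J.
Proof. by move=> kJ wJ; rewrite groupM // mem_gen // imset_f. Qed.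

Lemma X0_sgen mu k : k \in J0_ mu -> X0 mu * T (sgen k) = q *: X0 mu.
Proof.
move=> kJ; have -> : X0 mu = \sum_(w in parabolic (J0_ mu)) 1 *: T w.
  by apply: eq_bigr => w _; rewrite scale1r.
apply: (sum_T_sgen hT (kappa := 1)); rewrite ?mul1r ?mulr1 //.
- by move=> w; exact: parabolic_sgen.
- by rewrite addrC subrK.
Qed.

Lemma X1_sgen mu k : k \in J1_ mu -> X1 mu * T (sgen k) = - X1 mu.
Proof.
(* Along an ascent the coefficient is multiplied by [(-q)^-1], whence the eigenvalue
   [(-q)^-1 * q = -1]. *)
move=> kJ; rewrite -scaleN1r; apply: (sum_T_sgen hT (kappa := (- q)^-1)).
- by move=> w; exact: parabolic_sgen.
- by move=> w _ ->; rewrite exprSr invrM ?unitrX ?Nq_unit.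
- by rewrite -[X in _ * X]opprK mulrN mulVr ?Nq_unit.
- by rewrite mulrBr mulr1 -[X in _ * X]opprK mulrN mulVr ?Nq_unit // addrA subrr add0r mulN1r.
Qed.

Lemma X1_comm mu k : k \in J0_ mu -> X1 mu * T (sgen k) = T (sgen k) * X1 mu.
Proof.
move=> kJ; have kW : sgen k \in parabolic (J0_ mu) by rewrite mem_gen // imset_f.
rewrite mulr_suml mulr_sumr; apply: eq_bigr => w wJ.
have lkw := split_len (@J0_lt _ _ _ mu) (@J1_gt _ _ _ mu) kW wJ.
have ckw := split_comm (@J0_lt _ _ _ mu) (@J1_gt _ _ _ mu) kW wJ.
rewrite -scalerAl -scalerAr (T_mul hT lkw) (T_mul hT); first by rewrite ckw.
by rewrite -ckw lkw addnC.
Qed.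

(** The even factor carries the index character and the odd factor the sign character; an even
    generator first passes through the odd factor by [X1_comm]. *)
Lemma xy_sgen mu k : k \in J_ mu ->
  xy T mu * T (sgen k) = (if (lam_sum mu m < k)%N then -1 else q) *: xy T mu.
Proof.
rewrite /xy -/(X0 mu) -/(X1 mu); case/J_split/orP => kJ.
  rewrite ltnNge (ltnW (J0_lt kJ)) /=.
  by rewrite -mulrA X1_comm // mulrA X0_sgen // scalerAl.
by rewrite J1_gt // -mulrA X1_sgen // scaleN1r mulrN.
Qed.

Lemma parabolic_stab mu u0 u1 :
    u0 \in parabolic (J0_ mu) -> u1 \in parabolic (J1_ mu) ->
  wact (i_ mu) (u0 * u1) = i_ mu.
Proof.
move=> h0 h1; apply/eqP; rewrite -stab_parabolic ?dominant_i_ // eqgens_i_.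
have sub (J : {set 'I_d}) : J \subset J_ mu -> parabolic J \subset parabolic (J_ mu).
  by move=> sJ; rewrite genS // imsetS.
apply: groupM; [apply: (subsetP (sub (J0_ mu) _)) h0 | apply: (subsetP (sub (J1_ mu) _)) h1];
  by apply/subsetP=> k; rewrite inE => /andP[].
Qed.

Lemma xy_T mu g : g \in D_ mu ->
  xy T mu * T g = \sum_(u0 in parabolic (J0_ mu)) \sum_(u1 in parabolic (J1_ mu))
     (- q) ^- len u1 *: T (u0 * u1 * g)%g.
Proof.
move=> /minrep_D gD; rewrite /xy -mulrA mulr_suml; apply: eq_bigr => u0 h0.
rewrite mulr_suml mulr_sumr; apply: eq_bigr => u1 h1.
rewrite -scalerAl -scalerAr mulrA; congr (_ *: _).
have l01 := split_len (@J0_lt _ _ _ mu) (@J1_gt _ _ _ mu) h0 h1.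
by rewrite (T_mul hT l01) (T_mul hT) // gD // parabolic_stab.
Qed.

(* For g, h in D_ mu, the coefficient of T g in xy T mu * T h is (h == g)%:R. *)
Lemma xy_T_free mu (c : weyl d -> laurent) :
  \sum_(g in D_ mu) c g *: (xy T mu * T g) = 0 -> forall g, g \in D_ mu -> c g = 0.
Proof.
move=> e g gD.
pose P (t : weyl d * (weyl d * weyl d)) := [&& t.1 \in D_ mu,
  t.2.1 \in parabolic (J0_ mu) & t.2.2 \in parabolic (J1_ mu)].
have {e} e : \sum_(t | P t) (c t.1 * (- q) ^- len t.2.2) *: T (t.2.1 * t.2.2 * t.1)%g = 0.
  rewrite -[RHS]e -(pair_big (fun g => g \in D_ mu) 
       (fun t : weyl d * weyl d => (t.1 \in parabolic (J0_ mu)) && (t.2 \in parabolic (J1_ mu)))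
     (fun g t => (c g * (- q) ^- len t.2) *: T (t.1 * t.2 * g)%g)) /=.
  apply: eq_bigr => h hD; rewrite xy_T // scaler_sumr.
  rewrite -(pair_big (fun u => u \in parabolic (J0_ mu)) (fun u => u \in parabolic (J1_ mu))
    (fun u0 u1 => (c h * (- q) ^- len u1) *: T (u0 * u1 * h)%g)) /=.
  apply: eq_bigr => u0 _; rewrite scaler_sumr; apply: eq_bigr => u1 _.
  by rewrite scalerA.
(* Only the triple [(g, (1, 1))] contributes to [T g]: [u0 * u1 * h = g] gives [h = g] by
   [rep_uniq], and then [u0 * u1 = 1] with additive lengths gives [u0 = u1 = 1]. *)
have := hecke_free_fam hT e g; rewrite (big_pred1 (g, (1%g, 1%g))) /=.
  by rewrite len1 expr0 invr1 mulr1.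
move=> [h [u0 u1]]; rewrite /P /= !xpair_eqE; apply/andP/and3P.
  case=> /and3P[hD h0 h1] /eqP hg.
  have iu := parabolic_stab h0 h1.
  have [_ hg'] : mu = mu /\ h = g.
    by apply: rep_uniq => //; rewrite -hg wactM iu.
  have u01 : (u0 * u1 = 1)%g by apply: (mulIg g); rewrite mul1g -{1}hg' hg.
  have := split_len (@J0_lt _ _ _ mu) (@J1_gt _ _ _ mu) h0 h1.
  rewrite u01 len1 => /esym/eqP; rewrite addn_eq0 => /andP[/eqP/len_eq0-> /eqP/len_eq0->].
  by rewrite hg' !eqxx.
by case=> /eqP-> /eqP-> /eqP->; rewrite gD !group1 !mul1g eqxx.
Qed.

End XY.

(** * Signs and coordinates on the tensor space *)

Section Tensor.
Variables m n d : nat.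
Implicit Types (i : iseq d (m + n)) (k : 'I_d).

Lemma stat_pairs (F : sint (m + n) -> sint (m + n) -> nat) i :
  (\sum_(p in inv_pairs i) F (i p.1) (i p.2) +
   \sum_(p in neg_pairs i) F (i p.1) (i p.2))%N = stat F i.
Proof.
rewrite /stat big_mkcond /= [in X in (_ + X)%N]big_mkcond /=.
have -> : (\sum_k ((i k : int) < 0)%R * F (i k) (i k))%N =
    (\sum_(p : 'I_d * 'I_d) (p.1 == p.2) *
       (((i p.2 : int) < - (i p.1 : int))%R * F (i p.1) (i p.2)))%N.
  rewrite -(pair_bigA _ (fun k l => (k == l) *
       (((i l : int) < - (i k : int))%R * F (i k) (i l)))%N) /=.
  apply: eq_bigr => k _; rewrite (bigD1 k) //= eqxx mul1n big1 ?addn0.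
    by congr (nat_of_bool _ * _)%N; lia.
  by move=> l /negbTE lk; rewrite eq_sym lk.
rewrite -!big_split /=; apply: eq_bigr => -[k l] _ /=; rewrite !inE /= -val_eqE /=.
case: ((i l : int) < i k); case: ((i l : int) < - (i k : int)).
all: by case: (ltngtP k l) => _; rewrite /= ?mul1n ?mul0n ?addn0 ?add0n // mulnDl !mul1n.
Qed.

Lemma parityN (a : sint (m + n)) : parity m n (sint_opp a) = parity m n a.
Proof. by rewrite /parity sint_oppE abszN. Qed.

Lemma iparity_asc i k : (lft i k : int) < i k ->
  iparity m n (wact i (sgen k)) =
  iparity m n i (+) (parity m n (lft i k) && parity m n (i k)).
Proof.
pose F (a b : sint (m + n)) : nat := (parity m n a * parity m n b)%N.
have E (j : iseq d (m + n)) : iparity m n j = odd (stat F j) by rewrite -(stat_pairs F j).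
move=> lt; rewrite !E stat_asc // => [|a b|a b]; first by rewrite oddD oddM !oddb.
  by rewrite /F mulnC.
by rewrite /F parityN.
Qed.

(** For [k = 0] the left entry is the opposite of the right one: the exponent reduces to one parity,
    and equality means the entry 0, which is even. *)
Lemma eb_act_genE i k :
  let s := (parity m n (lft i k) * parity m n (i k))%N in
  eb_act_gen m n i k =
    if (lft i k : int) < i k then (-1) ^+ s *: eb m n (wact i (sgen k))
    else if lft i k == i k then (if parity m n (i k) then - eb m n i else q *: eb m n i)
    else ((-1) ^+ s * q) *: eb m n (wact i (sgen k)) + (q - 1) *: eb m n i.
Proof.
rewrite /= /eb_act_gen; case: (eqVneq (k : nat) 0%N) => k0; last first.
  by rewrite -lftS //; case: ltP => // _; case: eqP => // ->.
rewrite (lft0 _ k0) parityN mulnb andbb (sint_eqE (sint_opp _)) sint_oppE.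
have -> : (- (i k : int) < i k) = (0 < (i k : int)) by lia.
have -> : (- (i k : int) == i k) = ((i k : int) == 0) by lia.
by case: ltP => // _; case: eqP => // ik; rewrite /parity ik.
Qed.

Lemma sgn_unit (b : bool) : (-1) ^+ b \is a @GRing.unit laurent.
Proof. by rewrite unitrX // unitrN unitr1. Qed.

(** The only nonzero coordinate of the signed vector at [i]; being a unit, it makes these vectors a
    basis. *)
Definition ebu i : laurent :=
  (-1) ^+ iparity m n i * v ^+ (#|inv_pairs i| + #|neg_pairs i|).

Lemma ebu_unit i : ebu i \is a GRing.unit.
Proof. by rewrite unitrM sgn_unit unitrX // v_unit. Qed.

Lemma ebE i j : ((-1) ^+ iparity m n i *: eb m n i) j = ebu i * (j == i)%:R.
Proof.
rewrite !ffunE -[_ *: _]/(_ * _) -[X in _ * X]/(_ * _) mulrA; congr (_ * _).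
under eq_bigr => k _ do rewrite ffunE.
case: (eqVneq j i) => [->|/eqP ji]; first by rewrite big1 // => k _; rewrite eqxx.
have /existsP[k jk] : [exists k, j k != i k].
  by apply: contraT => /existsPn h; case: ji; apply/ffunP=> k; apply/eqP; have := h k; rewrite negbK.
by rewrite (bigD1 k) //= (negbTE jk) mul0r.
Qed.

End Tensor.

(** * The isomorphism *)

Lemma linear_scale (U V : lmodType laurent) (f : U -> V) a x : linear f ->
  f (a *: x) = a *: f x.
Proof.
move=> lf; pose g : {linear U -> V} := HB.pack f (GRing.isLinear.Build _ _ _ _ _ lf).
by rewrite -[f]/(g : U -> V) linearZ.
Qed.

Lemma linear_sumZ (U V : lmodType laurent) (f : U -> V) (I : finType) (P : pred I)
    (a : I -> laurent) (x : I -> U) : linear f ->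
  f (\sum_(t | P t) a t *: x t) = \sum_(t | P t) a t *: f (x t).
Proof.
move=> lf; pose g : {linear U -> V} := HB.pack f (GRing.isLinear.Build _ _ _ _ _ lf).
rewrite -[f]/(g : U -> V) linear_sum; apply: eq_bigr => t _.
by rewrite linearZ.
Qed.

Lemma sgen_hi_neq d (k : 'I_d) : sgval (sgen k) (hi k) != hi k.
Proof.
apply/eqP=> e; have h := wact_i0 (sgen k) k.
rewrite wact_sgen_hi -[in RHS]e permK in h.
by have := lft_i0_neq 1 k; rewrite wact1 h ffunE eqxx.
Qed.

Section DirectSum.
Variables (m n d : nat) (H : algType laurent).
Implicit Types (mu : weight m n d) (h : H).

Lemma dsum_act_in mu h h' : dsum_act (dsum_in mu h) h' = dsum_in mu (h * h').
Proof. by apply/ffunP=> nu; rewrite !ffunE; case: eqP => // _; rewrite mul0r. Qed.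

Lemma dsum_inZ mu c h : dsum_in mu (c *: h) = c *: dsum_in mu h.
Proof. by apply/ffunP=> nu; rewrite !ffunE; case: eqP => // _; rewrite scaler0. Qed.

Lemma dsum_inD mu h h' : dsum_in mu (h + h') = dsum_in mu h + dsum_in mu h'.
Proof. by apply/ffunP=> nu; rewrite !ffunE; case: eqP => // _; rewrite addr0. Qed.

Lemma dsum_act_linearl h : linear (fun y : {ffun weight m n d -> H} => dsum_act y h).
Proof. by move=> a y z; apply/ffunP=> nu; rewrite !ffunE mulrDl scalerAl. Qed.

Lemma dsum_act_linearr (y : {ffun weight m n d -> H}) : linear (dsum_act y).
Proof. by move=> a h h'; apply/ffunP=> nu; rewrite !ffunE mulrDr scalerAr. Qed.

Lemma dsum_act1 (y : {ffun weight m n d -> H}) : dsum_act y 1 = y.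
Proof. by apply/ffunP=> nu; rewrite !ffunE mulr1. Qed.

Lemma dsum_actM (y : {ffun weight m n d -> H}) h h' :
  dsum_act y (h * h') = dsum_act (dsum_act y h) h'.
Proof. by apply/ffunP=> nu; rewrite !ffunE mulrA. Qed.

End DirectSum.

Lemma sgn_sq (b : bool) : (-1) ^+ b * (-1) ^+ b = 1 :> laurent.
Proof. by rewrite -expr2 sqrr_sign. Qed.

Section Main.
Variables m n d : nat.
Local Notation pair := (weight m n d * weyl d)%type.
Implicit Types (i : iseq d (m + n)) (k : 'I_d) (p : pair).

Definition isrep p : bool := p.2 \in D_ p.1.
Definition pt p : iseq d (m + n) := wact (i_ p.1) p.2.
Definition seb i : Vtens m n d := (-1) ^+ iparity m n i *: eb m n i.

Lemma pt_inj p p' : isrep p -> isrep p' -> pt p = pt p' -> p = p'.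
Proof. by case: p p' => [mu g] [nu h] gD hD /(rep_uniq gD hD)[/= -> ->]. Qed.

Lemma pt_surj i : exists2 p, isrep p & pt p = i.
Proof. by have [p /andP[pD /eqP pi]] := rep_ex i; exists p. Qed.

Definition coord (x : Vtens m n d) p : laurent := x (pt p) / ebu (pt p).

Lemma coord_seb p p' : isrep p -> isrep p' -> coord (seb (pt p)) p' = (p' == p)%:R.
Proof.
move=> pD pD'; rewrite /coord ebE; case: (eqVneq p' p) => [->|pp].
  by rewrite eqxx mulr1 mulrV ?ebu_unit.
by case: eqP => [/(pt_inj pD' pD) e|]; [rewrite e eqxx in pp | rewrite mulr0 mul0r].
Qed.

Lemma sum_coord (x : Vtens m n d) : x = \sum_(p | isrep p) coord x p *: seb (pt p).
Proof.
apply/ffunP=> j; rewrite sum_ffunE; have [p0 pD <-] := pt_surj j.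
rewrite (bigD1 p0) //= big1 ?addr0 => [|p /andP[pD' pp]].
  by rewrite ffunE ebE eqxx mulr1 -[_ *: _]/(_ * _) mulrVK ?ebu_unit.
rewrite ffunE ebE; case: eqP => [/(pt_inj pD pD') e|]; first by rewrite e eqxx in pp.
by rewrite mulr0 scaler0.
Qed.

Lemma ebEsgn i : eb m n i = (-1) ^+ iparity m n i *: seb i.
Proof. by rewrite scalerA sgn_sq scale1r. Qed.

Variables (H : algType laurent) (T : weyl d -> H).
Hypothesis hT : is_hecke T.

Definition target p : {ffun weight m n d -> H} := dsum_in p.1 (xy T p.1 * T p.2).

Lemma target_asc mu g k : isrep (mu, g) ->
    (lft (pt (mu, g)) k : int) < pt (mu, g) k ->
  isrep (mu, g * sgen k)%g /\
  dsum_act (target (mu, g)) (T (sgen k)) = target (mu, g * sgen k)%g.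
Proof.
move=> /minrep_D mg /(minrep_asc (dominant_i_ mu) mg)[mgk lgk]; split.
  exact/minrep_D.
by rewrite dsum_act_in -mulrA T_asc.
Qed.

Lemma target_desc mu g k : isrep (mu, g) ->
    (pt (mu, g) k : int) < lft (pt (mu, g)) k ->
  isrep (mu, g * sgen k)%g /\
  dsum_act (target (mu, g)) (T (sgen k)) =
    q *: target (mu, g * sgen k)%g + (q - 1) *: target (mu, g).
Proof.
move=> /minrep_D mg lt; have mgk := minrep_desc (dominant_i_ mu) mg lt; split.
  exact/minrep_D.
(* Seen from [g * sgen k], the step back to [g] is an ascent, which determines the lengths. *)
have [|_] := minrep_asc (k := k) (dominant_i_ mu) mgk.
  by rewrite wactM wact_sgen_lo wact_sgen_hi.
rewrite mulgsK => lg.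
by rewrite dsum_act_in -mulrA T_desc // mulrDr -!scalerAr dsum_inD !dsum_inZ.
Qed.

(* With g * sgen k = sgen j * g, the value at position k comes from one of    *)
(* the two entries of i_ mu exchanged by sgen j.                              *)
Lemma target_eq mu g k : isrep (mu, g) ->
    lft (pt (mu, g)) k = pt (mu, g) k ->
  dsum_act (target (mu, g)) (T (sgen k)) =
    (if parity m n (pt (mu, g) k) then -1 else q) *: target (mu, g).
Proof.
move=> /minrep_D mg e; have [j jJ gj] := minrep_eq mg e.
have lj := mg (sgen j) (wact_sgen_id (eqgensP _ _ jJ)).
rewrite eqgens_i_ in jJ.
have -> : parity m n (pt (mu, g) k) = (lam_sum mu m < j)%N.
  rewrite /pt /= wact_entry wact_i0 parity_i_.
  set x := _ (hi k).
  have xj : sgval (sgen j) x != x.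
    have /(congr1 (fun w : weyl d => sgval w x)) := gj.
    rewrite /= !permM permKV => ex; apply: contraNneq (sgen_hi_neq k) => xj.
    by rewrite ex xj permKV.
  have : (absz x == j) || (absz x == j.+1).
    by apply: contraNT xj; rewrite negb_or => /andP[x1 x2]; rewrite sgen_fix.
  have Mj : lam_sum mu m != j.
    by rewrite neq_ltn; case/J_split/orP: jJ => [/J0_lt->|/J1_gt->]; rewrite ?orbT.
  by case/orP => /eqP-> //; rewrite ltnS leq_eqVlt (negbTE Mj).
rewrite dsum_act_in -mulrA T_asc //; last by rewrite gj lj len_sgen.
by rewrite gj -(T_mul hT lj) mulrA xy_sgen // -scalerAl dsum_inZ.
Qed.

Variable act : Vtens m n d -> H -> Vtens m n d.
Hypothesis hact : is_right_module act.
Hypothesis hgen : forall i k, act (eb m n i) (T (sgen k)) = eb_act_gen m n i k.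
Variable phi : {linear Vtens m n d -> {ffun weight m n d -> H}}.
Hypothesis phiE : forall p, isrep p -> phi (seb (pt p)) = target p.

Lemma phi_coord x : phi x = \sum_(p | isrep p) coord x p *: target p.
Proof.
rewrite [in LHS](sum_coord x) linear_sum; apply: eq_bigr => p pD.
by rewrite linearZ /= phiE.
Qed.

(** By [iparity_asc] the sign in the action is the quotient of the signs attached to [i] and
    [wact i (sgen k)], so all signs cancel and the rule for [target] remains. *)
Lemma phi_act_sgen p k : isrep p ->
  phi (act (seb (pt p)) (T (sgen k))) = dsum_act (target p) (T (sgen k)).
Proof.
case: p => mu g pD; have [lin _ _ _] := hact.
have actZ a x h : act (a *: x) h = a *: act x h := linear_scale a x (lin h).
have ptS : pt (mu, g * sgen k)%g = wact (pt (mu, g)) (sgen k) by rewrite /pt wactM.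
rewrite actZ hgen eb_act_genE linearZ /=.
set i := pt (mu, g) in ptS *.
have phi_eb p : isrep p -> phi (eb m n (pt p)) = (-1) ^+ iparity m n (pt p) *: target p.
  by move=> pD'; rewrite ebEsgn linearZ /= phiE.
case: (ltgtP (lft i k : int) (i k)) => [lt|gt|/sint_eqP e].
- have [pD' ->] := target_asc pD lt.
  rewrite linearZ /= -ptS phi_eb // ptS iparity_asc // signr_addb mulnb !scalerA.
  rewrite mulrA [_ * (-1) ^+ iparity _ _ _]mulrAC -mulrA.
  by rewrite mulrA !sgn_sq mul1r sgn_sq scale1r.
- have [pD' ->] := target_desc pD gt.
  rewrite sint_eqE gt_eqF // linearD [phi ((_ * q) *: _)]linearZ.
  rewrite [phi ((q - 1) *: _)]linearZ /= -ptS (phi_eb _ pD') (phi_eb _ pD) ptS -/i scalerDr !scalerA.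
  have -> : iparity m n i = iparity m n (wact i (sgen k))
      (+) (parity m n (lft i k) && parity m n (i k)).
    have := @iparity_asc m n d (wact i (sgen k)) k.
    by rewrite wact_sgenK wact_sgen_lo wact_sgen_hi andbC; apply.
  rewrite mulnb signr_addb; set s1 := (-1) ^+ _; set s2 := (-1) ^+ _.
  have s11 : s1 * s1 = 1 by exact: sgn_sq.
  have s22 : s2 * s2 = 1 by exact: sgn_sq.
  congr (_ *: _ + _ *: _); rewrite -/s1 -/s2.
    by transitivity ((s1 * s1) * (s2 * s2) * q); [ring | rewrite s11 s22 !mul1r].
  by transitivity ((s1 * s1) * (s2 * s2) * (q - 1)); [ring | rewrite s11 s22 !mul1r].
rewrite target_eq // -/i e eqxx.
case: ifP => _.
  by rewrite linearN (phi_eb _ pD) scalerN scalerA sgn_sq scale1r scaleN1r.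
by rewrite [phi (q *: _)]linearZ /= (phi_eb _ pD) !scalerA mulrAC sgn_sq mul1r.
Qed.

(** Equivariance passes from generators to each [T w] along a reduced word, and to [H] by
    linearity. *)
Lemma phi_act x h : phi (act x h) = dsum_act (phi x) h.
Proof.
have [linl linr act1 actM] := hact.
have sgen_case y k : phi (act y (T (sgen k))) = dsum_act (phi y) (T (sgen k)).
  rewrite [in LHS](sum_coord y) (linear_sumZ _ _ _ (linl _)) linear_sum phi_coord.
  rewrite (linear_sumZ _ _ _ (dsum_act_linearl _)); apply: eq_bigr => p pD.
  by rewrite linearZ /= phi_act_sgen.
have T_case w y : phi (act y (T w)) = dsum_act (phi y) (T w).
  move: w y; apply: len_ind => [|w k lw IH] y; first by rewrite T1 // act1 dsum_act1.
  by rewrite -(T_asc hT lw) actM sgen_case IH dsum_actM.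
have [c ->] := hecke_span hT h.
rewrite (linear_sumZ _ _ _ (linr x)) linear_sum (linear_sumZ _ _ _ (dsum_act_linearr _)).
by apply: eq_bigr => w _; rewrite linearZ /= T_case.
Qed.

Lemma phi_inj : injective phi.
Proof.
apply: raddf_inj => x /(etrans (esym (phi_coord x))) x0; rewrite (sum_coord x) big1 // => -[mu g] pD.
suff -> : coord x (mu, g) = 0 by rewrite scale0r.
apply: (xy_T_free hT (mu := mu) (c := fun h => coord x (mu, h))) pD.
(* In the component at [mu] the pairs with another weight vanish, leaving a relation for
   [xy_T_free]. *)
have /ffunP/(_ mu) := x0; rewrite sum_ffunE [in RHS]ffunE => e; rewrite -[RHS]e.
rewrite -(pair_big_dep predT (fun nu h => h \in D_ nu)
  (fun nu h => (coord x (nu, h) *: target (nu, h)) mu)) /= (bigD1 mu) //=.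
rewrite [X in _ + X]big1 ?addr0 => [|nu numu].
  by apply: eq_bigr => h _; rewrite !ffunE eqxx.
by apply: big1 => h _; rewrite !ffunE eq_sym (negbTE numu) scaler0.
Qed.

Lemma phi_image y : dsum_mem T y <-> exists x, phi x = y.
Proof.
split=> [/fin_all_exists[h yh]|[x <-] mu].
  have D1 mu : isrep (mu, 1%g) by apply/minrep_D; exact: minrep1.
  (* [target (mu, 1)] is the generator [xy T mu] of its summand, so acting by [h mu] yields the
     prescribed component. *)
  exists (\sum_mu act (seb (pt (mu, 1%g))) (h mu)); rewrite linear_sum /=.
  apply/ffunP=> nu; rewrite sum_ffunE (bigD1 nu) //= big1 ?addr0 => [|mu munu].
    by rewrite phi_act phiE // dsum_act_in !ffunE eqxx T1 // mulr1 yh.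
  by rewrite phi_act phiE // dsum_act_in !ffunE eq_sym (negbTE munu).
exists (\sum_(p | isrep p) coord x p *: (if mu == p.1 then T p.2 else 0)).
rewrite phi_coord sum_ffunE mulr_sumr; apply: eq_bigr => p _.
by rewrite !ffunE -scalerAr; case: eqP => [->|]; rewrite ?mulr0.
Qed.

End Main.

Theorem theorem2p12 (m n d : nat) (hd : (0 < d)%N)
  (H : algType laurent) (T : weyl d -> H) (hT : is_hecke T)
  (act : Vtens m n d -> H -> Vtens m n d) (hact : is_right_module act)
  (hgen : forall (i : iseq d (m + n)) (k : 'I_d),
     act (eb m n i) (T (sgen k)) = eb_act_gen m n i k) :
  let phi_spec (phi : {linear Vtens m n d -> {ffun weight m n d -> H}}) : Prop :=
    forall (mu : weight m n d) (g : weyl d), g \in D_ mu ->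
      let i := wact (i_ mu) g in
      phi ((-1) ^+ iparity m n i *: eb m n i) = dsum_in mu (xy T mu * T g) in
  (exists phi : {linear Vtens m n d -> {ffun weight m n d -> H}}, phi_spec phi) /\
  (forall phi : {linear Vtens m n d -> {ffun weight m n d -> H}}, phi_spec phi ->
     [/\ injective phi,
         forall y, dsum_mem T y <-> exists x, phi x = y
       & forall x h, phi (act x h) = dsum_act (phi x) h]).
Proof.
move=> phi_spec; split=> [|phi spec].
  pose f (x : Vtens m n d) := \sum_(p | isrep p) coord x p *: target T p.
  have lf : linear f.
    move=> a x y; rewrite /f scaler_sumr -big_split /=; apply: eq_bigr => p _.
    by rewrite /coord !ffunE mulrDl scalerDl scalerA mulrA.
  pose phi : {linear Vtens m n d -> {ffun weight m n d -> H}} :=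
    HB.pack f (GRing.isLinear.Build _ _ _ _ _ lf).
  exists phi => mu g gD i; rewrite -[phi _]/(f (seb (pt (mu, g)))) /f.
  rewrite (bigD1 (mu, g)) //= big1 ?addr0 => [|p /andP[pD pp]].
    by rewrite coord_seb // eqxx scale1r.
  by rewrite coord_seb // (negbTE pp) scale0r.
have phiE p : isrep p -> phi (seb (pt p)) = target T p by case: p => mu g; exact: spec.
split; [exact: (phi_inj hT phiE) | exact: (phi_image hT hact hgen phiE)
  | exact: (phi_act hT hact hgen phiE)].
Qed.
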